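(* Let $u\in\mathcal{L}PSH^*(\mathbb{C}^n)$ be toric with $c_\infty(u)<1$. Then $\mathcal{P}_\infty(u)=\mathcal{P}_\infty(\Psi_u)$, and this vector space is generated (as a $\mathbb{C}$-vector space) by the monomials $z^J$, $J\in\mathbb{Z}_{\ge0}^n$, such that $J+\mathbf 1$ belongs to the interior of $\Gamma_{u,\infty}$.
   Context: $\mathcal{L}PSH(\mathbb{C}^n)$: plurisubharmonic $u$ on $\mathbb{C}^n$ with $\limsup_{|z|\to\infty}u(z)/\log|z|<\infty$; $\mathcal{L}PSH^*(\mathbb{C}^n)$: those with $u(z)\to+\infty$ as $|z|\to\infty$. Toric: $u(z)=u(|z_1|,\ldots,|z_n|)$. $g\in L^2(\infty)$ means $\int_{\mathbb{C}^n\setminus K}|g|^2d\lambda<\infty$ for some compact $K$; $c_\infty(u)=\inf\{c>0:e^{-cu}\in L^2(\infty)\}$. $\mathcal{P}_\infty(u)$ is the set of polynomials $P:\mathbb{C}^n\to\mathbb{C}$ with $|P|e^{-u}\in L^2(\infty)$. The logarithmic indicator is $\Psi_u(z)=\lim_{R\to\infty}R^{-1}\sup\{u(\zeta):|\zeta_k|\le|z_k|^R,\ 1\le k\le n\}$ for $z_1\cdots z_n\neq0$, extended by continuity; $\psi_u(t)=\Psi_u(e^{t_1},\ldots,e^{t_n})$; $\Gamma_{u,\infty}=\{a\in\mathbb{R}^n:\langle a,t\rangle\le\max\{\psi_u(t),0\}\ \forall t\in\mathbb{R}^n\}$; $\mathbf 1=(1,\ldots,1)$. *)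

(* Defs.v *)
From HB Require Import structures.
From mathcomp Require Import all_boot all_order all_algebra.
From mathcomp Require Import all_classical all_reals all_analysis.
From mathcomp Require Import complex.
Import Order.TTheory GRing.Theory Num.Theory.
Import numFieldTopology.Exports numFieldNormedType.Exports.

Set Implicit Arguments.
Unset Strict Implicit.
Unset Printing Implicit Defensive.

Local Open Scope ring_scope.
Local Open Scope classical_set_scope.

Section Defs.
Variable R : realType.

Definition cabs (z : R[i]) : R := Num.sqrt (complex.Re z ^+ 2 + complex.Im z ^+ 2).

Definition Cn (n : nat) := 'I_n -> R[i].

Definition cnorm n (z : Cn n) : R := Num.sqrt (\sum_(k < n) cabs (z k) ^+ 2).

(* the standard identification R^{2n} = 'M[R]_(n,2) -> C^n
   (row k = (Re z_k, Im z_k)); it defines the topology of C^n *)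
Definition realify n (A : 'M[R]_(n, 2)) : Cn n :=
  fun k => Complex (A k ord0) (A k ord_max).

Definition cn_compact n (K : set (Cn n)) := compact (realify (n:=n) @^-1` K).

Fixpoint iter_int (m : nat) (f : (nat -> R) -> \bar R) : \bar R :=
  match m with
  | 0 => f (fun _ => 0)
  | m'.+1 => (\int[@lebesgue_measure R]_(x in setT)
               iter_int m' (fun v => f (fun k => if k is k'.+1 then v k' else x)))%E
  end.

(* Lebesgue integral over C^n = R^{2n} (coordinates Re z_k = v (2k),
   Im z_k = v (2k+1)); for nonnegative measurable F it is the integral
   w.r.t. Lebesgue measure of C^n by Tonelli *)
Definition cn_integral n (F : Cn n -> \bar R) : \bar R :=
  iter_int (2 * n) (fun v => F (fun k => Complex (v (2 * k)%N) (v (2 * k).+1))).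

Definition L2inf n (g : Cn n -> \bar R) :=
  exists K : set (Cn n), cn_compact K /\
    (cn_integral (fun z => if `[< K z >] then 0%E else (`|g z| * `|g z|)%E)
       < +oo)%E.

Definition usc n (u : Cn n -> \bar R) :=
  forall (z : Cn n) (c : R), (u z < c%:E)%E ->
    exists2 d : R, 0 < d &
      forall w : Cn n, (forall k, cabs (w k - z k) < d) -> (u w < c%:E)%E.

Definition psh n (u : Cn n -> \bar R) :=
  [/\ (forall z, u z < +oo)%E, usc u, (exists z, u z != -oo)%E &
      forall a b : Cn n,
        (u a <= ((2 * pi)^-1)%:E *
           \int[@lebesgue_measure R]_(t in `[0%R, (2 * pi)%R]%classic)
              u (fun k => (a k + Complex (cos t) (sin t) * b k)%R))%E].

Definition LPSH n (u : Cn n -> \bar R) :=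
  psh u /\ exists C r : R, forall z : Cn n, r < cnorm z ->
     (u z <= (C * ln (cnorm z))%:E)%E.

Definition LPSHstar n (u : Cn n -> \bar R) :=
  LPSH u /\ forall M : R, exists r : R, forall z : Cn n, r < cnorm z ->
     (M%:E < u z)%E.

Definition toric n (u : Cn n -> \bar R) :=
  forall z w : Cn n, (forall k, cabs (z k) = cabs (w k)) -> u z = u w.

Definition c_inf n (u : Cn n -> \bar R) : \bar R :=
  ereal_inf [set c%:E | c in [set c : R | 0 < c /\
                   L2inf (fun z => expeR (- (c%:E * u z)))%E]].

Definition monom n (J : 'I_n -> nat) (z : Cn n) : R[i] := \prod_(k < n) z k ^+ J k.

Definition is_poly n (P : Cn n -> R[i]) :=
  exists m (J : 'I_m -> 'I_n -> nat) (c : 'I_m -> R[i]),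
    forall z, P z = \sum_(i < m) c i * monom (J i) z.

Definition P_inf n (u : Cn n -> \bar R) (P : Cn n -> R[i]) :=
  is_poly P /\ L2inf (fun z => (cabs (P z))%:E * expeR (- u z))%E.

Definition in_torus n (z : Cn n) : bool := [forall k, z k != 0].

Definition Psi0 n (u : Cn n -> \bar R) (z : Cn n) : \bar R :=
  lim (((r^-1)%:E *
         ereal_sup (u @` [set zeta : Cn n |
                     forall k, (cabs (zeta k) <= cabs (z k) `^ r)%R]))%E
       @[r --> +oo]).

(* logarithmic indicator Psi_u: the formula on the torus, extended to the
   coordinate hyperplanes by (upper semi)continuity, i.e. by the limsup of
   its values at nearby torus points *)
Definition Psi n (u : Cn n -> \bar R) (z : Cn n) : \bar R :=
  if in_torus z then Psi0 u z
  else ereal_inf [set ereal_sup (Psi0 u @` [set w : Cn n | in_torus w /\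
                     forall k, cabs (w k - z k) < d]) | d in [set d : R | 0 < d]].

Definition psi n (u : Cn n -> \bar R) (t : 'rV[R]_n) : \bar R :=
  Psi u (fun k => Complex (expR (t ord0 k)) 0).

Definition Gamma_inf n (u : Cn n -> \bar R) : set 'rV[R]_n :=
  [set a | forall t : 'rV[R]_n,
     ((\sum_(k < n) a ord0 k * t ord0 k)%:E <= maxe (psi u t) 0)%E].

Definition shift1 n (J : 'I_n -> nat) : 'rV[R]_n := \row_k ((J k).+1)%:R.

End Defs.

(* Main.v *)
(** Being toric and plurisubharmonic, u is on the torus a function phi of
    t = (log |z_1|, ..., log |z_n|), where phi is convex and nondecreasing in each t_k,
    and psi_u is the recession function of phi.  Convexity comes from comparing u on small
    circles with quadratic functions touching phi from above; monotonicity from convexity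
    and boundedness of u near the coordinate hyperplanes.  A compactness argument shows
    that J + 1 lies in the interior of Gamma iff phi^+(t) - <J + 1, t> grows at least
    linearly; then |z^J|^2 e^{-2u} is integrable at infinity.  Conversely, if J + 1 is
    not interior for some monomial that cannot be dropped from P, then <J + 1, t0> >=
    psi_u^+(t0) for some direction t0, and |P|^2 e^{-2u} has an infinite integral along
    the ray spanned by t0.  Both parts only use phi - c <= w <= psi_u + c on the torus
    for the weight w, which holds for w = u and for w = Psi_u. *)
Require Import Defs.
From HB Require Import structures.
From mathcomp Require Import all_boot all_order all_algebra.
From mathcomp Require Import all_classical all_reals all_analysis.
From mathcomp Require Import measurable_realfun complex.
From mathcomp Require Import ring lra.
Import Order.TTheory GRing.Theory Num.Theory.
Import numFieldTopology.Exports numFieldNormedType.Exports.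

Set Implicit Arguments.
Unset Strict Implicit.
Unset Printing Implicit Defensive.

Local Open Scope ring_scope.
Local Open Scope classical_set_scope.

(** The integral over C^n is an iterated one and the integrand is never shown measurable, so it is
    only compared pointwise with finite sums of products of one-variable functions. This shapes both
    halves. For finiteness the majorant is a constant times the product, over all 2 n real
    coordinates x, of 1 / (|x| (1 + e^2 log^2 |x|)), which takes the place of polar coordinates; for
    divergence the minorant is a sum of multiples of indicators of disjoint boxes. The vector 1 in J
    + 1 is half of the exponent of the volume factor e^{2 (t_1 + ... + t_n)} of logarithmic
    coordinates. The positive part in psi_u^+ reflects that only infinity matters: u > 0 outside a
    polydisc, and a nonzero direction t0 with <J + 1, t0> >= 0 has a positive component, hence
    leaves every compact set. *)

(** * Iterated integrals and an integrable weight on the line *)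

Section Integration.
Variable R : realType.
Local Notation mu := (@lebesgue_measure R).
Local Open Scope ereal_scope.

(* No measurability is needed: the integral is a supremum over simple functions. *)
Lemma le_integral_pointwise (D : set R) (f g : R -> \bar R) :
  (forall x, D x -> f x <= g x) ->
  \int[mu]_(x in D) f x <= \int[mu]_(x in D) g x.
Proof.
move=> fg; rewrite /integral.
have le_patch x : (f \_ D) x <= (g \_ D) x.
  by rewrite /patch; case: ifPn => // /set_mem /fg.
apply: leeB; apply: ereal_sup_le => _ [h hle <-]; exists h => //= x;
  apply: le_trans (hle x) _.
- by rewrite !funeposE ge_max !le_max le_patch lexx orbT.
- by rewrite !funenegE ge_max !le_max leeN2 le_patch lexx orbT.
Qed.

Lemma iter_int_ge0 d (f : (nat -> R) -> \bar R) :
  (forall v, 0 <= f v) -> 0 <= iter_int d f.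
Proof.
elim: d f => [|d IH] f f0 /=; first exact: f0.
by apply: integral_ge0 => x _; apply: IH => v.
Qed.

Lemma le_iter_int d (f g : (nat -> R) -> \bar R) :
  (forall v, f v <= g v) -> iter_int d f <= iter_int d g.
Proof.
elim: d f g => [|d IH] f g fg /=; first exact: fg.
by apply: le_integral_pointwise => x _; apply: IH => v.
Qed.

(** Once the first variable x is fixed, its factor joins the coefficient, and the induction
    hypothesis applies with coefficients [c i * g i 0 x]. These are the only integrands evaluated
    exactly: one product of weights for the upper bound, sums of indicators of boxes for the lower
    bound. *)
Lemma iter_int_sum_prod d M (c : 'I_M -> \bar R) (g : 'I_M -> nat -> R -> \bar R) :
  (forall i, 0 <= c i) -> (forall i j x, 0 <= g i j x) ->
  (forall i j, measurable_fun [set: R] (g i j)) ->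
  iter_int d (fun v => \sum_(i < M) c i * \prod_(j < d) g i j (v j)) =
  \sum_(i < M) c i * \prod_(j < d) \int[mu]_x g i j x.
Proof.
elim: d c g => [|d IH] c g c0 g0 mg /=.
  by apply: eq_bigr => i _; rewrite !big_ord0.
have E x : iter_int d (fun v => \sum_(i < M) c i * \prod_(j < d.+1)
     g i j (if nat_of_ord j is k.+1 then v k else x)) =
   \sum_(i < M) (c i * \prod_(j < d) \int[mu]_y g i j.+1 y) * g i 0%N x.
  under eq_fun => v do under eq_bigr => i _ do
    rewrite big_ord_recl /= muleA.
  rewrite (IH (fun i => c i * g i 0%N x) (fun i j => g i j.+1)) //.
    by apply: eq_bigr => i _; rewrite muleAC.
  by move=> i; apply: mule_ge0.
under eq_fun do rewrite E.
have p0 i : 0 <= \prod_(j < d) \int[mu]_y g i j.+1 y.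
  by apply: prode_ge0 => j _; apply: integral_ge0.
rewrite ge0_integral_sum //=.
- apply: eq_bigr => i _.
  rewrite ge0_integralZl; [|exact: measurableT|exact: mg|by move=> *; apply: g0|exact: mule_ge0].
  by rewrite -muleA big_ord_recl /=; congr (_ * _); rewrite muleC.
- by move=> i; apply: measurable_funeM; exact: mg.
- by move=> i x _; rewrite !mule_ge0.
Qed.


Local Open Scope ring_scope.

(** Away from 0 this is 1 / (|x| (1 + e^2 log^2 |x|)), barely integrable at 0 and at infinity. The
    form [expR (- ln |x|)] keeps it positive at 0 too, where the inverse of |x| would be 0. *)
Definition logw (e x : R) : R := expR (- ln `|x|) * (1 + (e * ln `|x|) ^+ 2)^-1.

Lemma logw_gt0 e x : 0 < logw e x.
Proof. by rewrite mulr_gt0 ?expR_gt0 // invr_gt0 ltr_wpDr // sqr_ge0. Qed.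

Lemma continuous_invD1sqr : continuous (fun s : R => (1 + s ^+ 2)^-1).
Proof.
move=> s; apply: cvgV; first by rewrite gt_eqF // ltr_wpDr // sqr_ge0.
by apply: cvgD; [exact: cvg_cst|exact: exprn_continuous].
Qed.

Lemma measurable_logw e : measurable_fun [set: R] (logw e).
Proof.
have ml : measurable_fun [set: R] (fun x : R => ln `|x|).
  by apply: measurableT_comp; [exact: measurable_ln|exact: normr_measurable].
apply: measurable_funM.
  by apply: measurableT_comp => //; apply: measurableT_comp.
apply: (@measurableT_comp _ _ _ _ _ _ (fun s : R => (1 + s ^+ 2)^-1)).
  by apply: continuous_measurable_fun; exact: continuous_invD1sqr.
by apply: measurable_funM.
Qed.

Lemma is_derive_atan_ln (e x : R) : 0 < e -> 0 < x ->
  is_derive x 1 (fun y => e^-1 * atan (e * ln y)) (logw e x).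
Proof.
move=> e0 x0.
have dl := is_derive1_ln x0.
have dg : is_derive x 1 (fun y : R => e * ln y) (e * x^-1).
  by apply: is_deriveZ.
have dc := @is_derive1_comp R atan (fun y => e * ln y) x _ _ (is_derive1_atan (e * ln x)) dg.
have := @is_deriveZ R R R (atan \o (fun y => e * ln y)) e^-1 x 1 _ dc.
move=> H; suff -> : logw e x = e^-1 * ((1 + (e * ln x) ^+ 2)^-1 * (e * x^-1)) by exact: H.
rewrite [X in e^-1 * X]mulrC -mulrA mulKf ?gt_eqF //.
by rewrite /logw gtr0_norm // expRN lnK.
Qed.

Lemma continuous_logw_pos (e x : R) : 0 < x -> {for x, continuous (logw e)}.
Proof.
move=> x0.
have cl : {for x, continuous (fun y : R => ln `|y|)}.
  apply: (@continuous_comp _ _ _ _ (@ln R)); first exact: norm_continuous.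
  by apply: continuous_ln; rewrite normr_gt0 gt_eqF.
apply: cvgM.
  apply: (continuous_comp (f := fun y : R => - ln `|y|)).
    exact: cvgN.
  exact: continuous_expR.
apply: (continuous_comp (f := fun y : R => e * ln `|y|) (g := fun s => (1 + s ^+ 2)^-1)).
  by apply: cvgM => //; exact: cvg_cst.
exact: continuous_invD1sqr.
Qed.

(** The antiderivative atan (e log x) / e varies by at most pi / e, whatever the interval. *)
Lemma integral_logw_le (e a b : R) : 0 < e -> 0 < a -> a < b ->
  (\int[mu]_(x in `[a, b]%classic) (logw e x)%:E <= (e^-1 * pi)%:E)%E.
Proof.
move=> e0 a0 ab.
have pos x : x \in `[a, b] -> 0 < x.
  by rewrite in_itv /= => /andP[+ _]; exact: lt_le_trans.
have dF x : 0 < x -> derivable (fun y => e^-1 * atan (e * ln y)) x 1.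
  by move=> /(is_derive_atan_ln e0) [].
have cF x : 0 < x -> {for x, continuous (fun y => e^-1 * atan (e * ln y))}.
  by move=> /dF /derivable1_diffP /differentiable_continuous.
rewrite (@continuous_FTC2 _ _ (fun y => e^-1 * atan (e * ln y))) //.
- rewrite -EFinB lee_fin -mulrBr ler_pM2l ?invr_gt0 //.
  have := atan_ltpi2 (e * ln b); have := atan_gtNpi2 (e * ln a).
  lra.
- apply: continuous_in_subspaceT => x /set_mem /pos; exact: continuous_logw_pos.
- split.
  + by move=> x /subset_itv_oo_cc /pos /dF.
  + by apply: cvg_at_right_filter; apply: cF.
  + by apply: cvg_at_left_filter; apply: cF; exact: lt_trans ab.
- move=> x /subset_itv_oo_cc /pos x0.
  by rewrite derive1E; have [_ ->] := is_derive_atan_ln e0 x0.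
Qed.

(* Infinite at 0, so that no bound is required on the coordinate hyperplanes. *)
Definition logwe (e x : R) : \bar R := if x == 0 then +oo%E else (logw e x)%:E.

Lemma logwe_ge0 e x : (0 <= logwe e x)%E.
Proof. by rewrite /logwe; case: ifP => // _; rewrite lee_fin ltW // logw_gt0. Qed.

Lemma measurable_logwe e : measurable_fun [set: R] (logwe e).
Proof.
apply: measurable_fun_ifT => //.
  by apply: measurable_fun_eqr.
by apply/measurable_EFinP; exact: measurable_logw.
Qed.

Lemma integral_logwe_lty e : 0 < e -> (\int[mu]_x logwe e x < +oo)%E.
Proof.
move=> e0.
(* Starting at 2 makes each interval nondegenerate, as [integral_logw_le] requires. *)
pose F (i : nat) := `[i.+2%:R^-1, i.+2%:R]%classic : set R.
pose G (i : nat) := `[- i.+2%:R, - i.+2%:R^-1]%classic : set R.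
have i0 (i : nat) : 0 < i.+2%:R^-1 :> R by rewrite invr_gt0.
have i1 (i : nat) : i.+2%:R^-1 < i.+2%:R :> R.
  by rewrite (@lt_trans _ _ 1) // ?invf_lt1 // ltr1n.
have leF i : (\int[mu]_(x in F i) logwe e x <= (e^-1 * pi)%:E)%E.
  apply: le_trans (integral_logw_le e0 (i0 i) (i1 i)).
  apply: le_integral_pointwise => x /=; rewrite /F /= in_itv /= => /andP[ix _].
  by rewrite /logwe gt_eqF // (lt_le_trans _ ix).
have leG i : (\int[mu]_(x in G i) logwe e x <= (e^-1 * pi)%:E)%E.
  apply: le_trans (integral_logw_le e0 (i0 i) (i1 i)).
  have logwN x : logw e (- x) = logw e x by rewrite /logw normrN.
  rewrite [leRHS](_ : _ = \int[mu]_(x in F i) ((logw e \o -%R) x)%:E)%E; last first.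
    by apply: eq_integral => x _ /=; rewrite logwN.
  rewrite -integration_by_substitution_oppr; last 2 first.
  - exact: ltW.
  - have neg x : x \in `[- i.+2%:R, - i.+2%:R^-1] -> x < 0.
      rewrite in_itv /= => /andP[_ xi].
      by rewrite (le_lt_trans xi) // oppr_lt0.
    apply: continuous_in_subspaceT => x /set_mem /neg xi.
    rewrite (_ : logw e = logw e \o -%R); last by apply/funext => y /=; rewrite logwN.
    apply: continuous_comp; first exact: opp_continuous.
    by apply: continuous_logw_pos; rewrite oppr_gt0.
  apply: le_integral_pointwise => x; rewrite /G /= in_itv /= => /andP[_ ix].
  by rewrite /logwe lt_eqF // (le_lt_trans ix) // oppr_lt0.
have leU (H : nat -> set R) : (forall i, measurable (H i)) -> nondecreasing_seq H ->
    (forall i, \int[mu]_(x in H i) logwe e x <= (e^-1 * pi)%:E)%E ->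
    (\int[mu]_(x in \bigcup_i H i) logwe e x <= (e^-1 * pi)%:E)%E.
  move=> mH ndH leH.
  have C := @ge0_nondecreasing_set_cvg_integral _ (measurableTypeR R) R H (logwe e) mu ndH mH
    (fun i => measurable_funTS (measurable_logwe e)) (fun i x _ => logwe_ge0 e x).
  by apply: cvge_le C; near=> i; exact: leH.
have sFG : [set: R] = (\bigcup_i F i `|` (\bigcup_i G i)) `|` [set 0].
  apply/seteqP; split=> // x _.
  have [->|x0] := eqVneq x 0; first by right.
  left.
  have nx0 : 0 < `|x| by rewrite normr_gt0.
  (* An integer above y bounds both |x| and its inverse, so its interval, or the mirror image,
     contains x. *)
  pose y := `|x| + `|x|^-1.
  have y0 : 0 <= y by rewrite addr_ge0 // invr_ge0 ltW.
  have [k yk] : exists k : nat, y <= k.+2%:R.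
    exists (Num.bound y); rewrite ltW // (lt_trans (archi_boundP y0)) // ltr_nat.
    by rewrite ltnS leqnSn.
  have h1 : `|x| <= k.+2%:R.
    by apply: le_trans yk; rewrite lerDl invr_ge0 ltW.
  have h2 : k.+2%:R^-1 <= `|x|.
    rewrite -[leRHS]invrK lef_pV2 ?posrE ?invr_gt0 //.
    by apply: le_trans yk; rewrite lerDr ltW.
  have [xp|xn] := ltP 0 x.
    by left; exists k => //=; rewrite /F /= in_itv /=; move: h1 h2; rewrite gtr0_norm // => -> ->.
  right; exists k => //=; rewrite /G /= in_itv /=; move: h1 h2; rewrite ler0_norm // => h1 h2.
  by rewrite lerNl h1 lerNr.
have mF i : measurable (F i) by exact: measurable_itv.
have mG i : measurable (G i) by exact: measurable_itv.
have mUF : measurable (\bigcup_i F i) by apply: bigcup_measurable.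
have mUG : measurable (\bigcup_i G i) by apply: bigcup_measurable.
have ile (i j : nat) : (i <= j)%N -> j.+2%:R^-1 <= i.+2%:R^-1 :> R.
  by move=> ij; rewrite lef_pV2 ?posrE // ler_nat.
have ler2 (i j : nat) : (i <= j)%N -> i.+2%:R <= j.+2%:R :> R.
  by move=> ij; rewrite ler_nat.
have UF : (\int[mu]_(x in \bigcup_i F i) logwe e x <= (e^-1 * pi)%:E)%E.
  apply: leU => // i j ij; apply/subsetPset; rewrite /F => x /=.
  rewrite !in_itv /= => /andP[h1 h2]; apply/andP; split.
    exact: le_trans (ile _ _ ij) h1.
  exact: le_trans h2 (ler2 _ _ ij).
have UG : (\int[mu]_(x in \bigcup_i G i) logwe e x <= (e^-1 * pi)%:E)%E.
  apply: leU => // i j ij; apply/subsetPset; rewrite /G => x /=.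
  rewrite !in_itv /= => /andP[h1 h2]; apply/andP; split.
    by apply: le_trans h1; rewrite lerN2; exact: ler2.
  by apply: le_trans h2 _; rewrite lerN2; exact: ile.
rewrite sFG.
have leIU (A B : set R) : measurable A -> measurable B ->
    (\int[mu]_(x in A `|` B) logwe e x <=
     \int[mu]_(x in A) logwe e x + \int[mu]_(x in B) logwe e x)%E.
  move=> mA mB.
  apply: le_trans (_ : \int[mu]_(x in A) logwe e x +
     \int[mu]_(x in B `\` A) logwe e x <= _)%E.
    rewrite -ge0_integral_setU //; last 4 first.
    - exact: measurableD.
    - by apply: measurable_funTS; exact: measurable_logwe.
    - by move=> *; exact: logwe_ge0.
    - by apply/disj_setPS => x [] Ax [].
    by rewrite setDE setUIr setUv setIT.
  apply: leeD2l; apply: ge0_subset_integral => //.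
  - exact: measurableD.
  - by apply: measurable_funTS; exact: measurable_logwe.
  - by move=> *; exact: logwe_ge0.
apply: le_lt_trans (leIU _ _ _ _) _ => //; first exact: measurableU.
(* The infinite value at 0 contributes nothing, a point being a null set. *)
rewrite integral_set1 adde0.
apply: le_lt_trans (leIU _ _ mUF mUG) _.
by apply: le_lt_trans (leeD UF UG) _; rewrite -EFinD ltry.
Unshelve. all: by end_near. Qed.

End Integration.

(** * Maxima of upper semicontinuous functions on compact sets *)

Section SemicontinuousMax.
Variables (R : realType) (T : topologicalType).

(** The open sublevel sets f < c are used twice as a near covering: with c near +oo they bound f,
    and if the supremum s were not attained, c tending to s from the left would give a bound below
    s. *)
Lemma usc_compact_max (K : set T) (f : T -> \bar R) :
  compact K -> K !=set0 -> (forall x, K x -> (f x < +oo)%E) ->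
  (forall x c, K x -> (f x < c%:E)%E -> \forall y \near x, (f y < c%:E)%E) ->
  exists2 x, K x & forall y, K y -> (f y <= f x)%E.
Proof.
move=> /compact_near_coveringP cK [x0 Kx0] fy uscf.
have [N fN] : exists N : R, forall x, K x -> (f x < N%:E)%E.
  have : \forall c \near +oo%R, K `<=` [set x | (f x < c%:E)%E].
    apply: cK => x Kx.
    have [c fc] : exists c : R, (f x < c%:E)%E.
      have := fy _ Kx; case: (f x) => [r _|//|_].
      - by exists (r + 1); rewrite lte_fin ltrDl.
      - by exists 0; rewrite ltNyr.
    near=> x' c' => /=.
    apply: (@lt_le_trans _ _ c%:E).
      by near: x'; exact: uscf.
    by rewrite lee_fin; near: c'; apply: nbhs_pinfty_ge; rewrite num_real.
  by move=> /filter_ex [N KN]; exists N.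
have supN : (ereal_sup (f @` K) <= N%:E)%E.
  by apply: ge_ereal_sup => _ [x Kx <-]; exact/ltW/fN.
have fle x : K x -> (f x <= ereal_sup (f @` K))%E.
  by move=> Kx; apply: ereal_sup_ubound; exists x.
apply: contrapT => nmax.
have flt x : K x -> (f x < ereal_sup (f @` K))%E.
  move=> Kx; rewrite lt_neqAle fle // andbT; apply/eqP => fxS.
  by apply: nmax; exists x => // y Ky; rewrite fxS fle.
have := flt _ Kx0; move: flt supN.
case supE : (ereal_sup (f @` K)) => [s|//|]; last by move=> _ _; rewrite ltNge leNye.
move=> flt _ _.
have : \forall c \near s^'-, K `<=` [set x | (f x < c%:E)%E].
  apply: cK => x Kx.
  have [c fc cs] : exists2 c : R, (f x < c%:E)%E & c < s.
    have := flt _ Kx; case: (f x) => [r|//|_].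
    - by rewrite lte_fin => rs; exists ((r + s) / 2); rewrite ?lte_fin midf_lt.
    - by exists (s - 1); rewrite ?ltNyr // ltrBlDr ltrDl.
  near=> x' c' => /=.
  apply: (@lt_le_trans _ _ c%:E).
    by near: x'; exact: uscf.
  by rewrite lee_fin ltW //; near: c'; apply: nbhs_left_gt.
move=> H; have /filter_ex [c [Kc cs]] :
    \forall c \near s^'-, K `<=` [set x | (f x < c%:E)%E] /\ c < s.
  by apply: filterI; [exact: H|exact: nbhs_left_lt].
have : (ereal_sup (f @` K) <= c%:E)%E.
  by apply: ge_ereal_sup => _ [x Kx <-]; exact/ltW/Kc.
by rewrite supE lee_fin leNgt cs.
Unshelve. all: by end_near. Qed.

End SemicontinuousMax.

(** * Second order expansion of the logarithm *)

Section LogTaylor.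
Variable R : realType.

(** The difference of the two sides has derivative z^3 / (1 + z), of the sign of z, so its minimum
    is its value 0 at 0. *)
Lemma ln1D_le (y : R) : -1 < y -> ln (1 + y) <= y - y ^+ 2 / 2 + y ^+ 3 / 3.
Proof.
move=> y1.
pose g (z : R) := z - z ^+ 2 / 2 + z ^+ 3 / 3 - ln (1 + z).
pose dg (z : R) := z ^+ 3 / (1 + z).
have dgP (z : R) : -1 < z -> is_derive z 1 g (dg z).
  move=> z1.
  have z0 : 0 < 1 + z by lra.
  have d1 : is_derive z 1 (fun z : R => 1 + z) (0 + 1) by apply: is_deriveD.
  have dl := @is_derive1_comp R (@ln R) (fun z => 1 + z) z _ _ (is_derive1_ln z0) d1.
  have dp : is_derive z 1 (horner ('X - 2^-1 *: 'X^2 + 3^-1 *: 'X^3))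
     ('X - 2^-1 *: 'X^2 + 3^-1 *: 'X^3)^`().[z] by apply: is_derive_poly.
  have gE : g = horner ('X - 2^-1 *: 'X^2 + 3^-1 *: 'X^3) \- (@ln R \o (fun z => 1 + z)).
    by apply/funext => w; rewrite /g /= !(hornerE, hornerXn) /=; ring.
  rewrite gE; apply: is_derive_eq (is_deriveB dp dl) _.
  rewrite derivD derivB !derivZ derivX !derivXn !(hornerE, hornerXn, hornerMn) /= /dg; field; lra.
have cg (z : R) : -1 < z -> {for z, continuous g}.
  by move=> /dgP [/derivable1_diffP /differentiable_continuous].
suff : 0 <= g y by rewrite /g; lra.
have g0 : g 0 = 0 by rewrite /g addr0 ln1; lra.
have [yge|ylt] := leP 0 y.
- have [||c] := @MVT_segment R g dg 0 y yge.
  + by move=> x; rewrite in_itv /= => /andP[x0 _]; apply: dgP; lra.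
  + apply: continuous_in_subspaceT => x /set_mem /=; rewrite in_itv /= => /andP[x0 _].
    by apply: cg; lra.
  rewrite in_itv /= => /andP[c0 cy]; rewrite g0 !subr0 => ->.
  by rewrite mulr_ge0 // divr_ge0 ?exprn_ge0 //; lra.
- have [||c] := @MVT_segment R g dg y 0 (ltW ylt).
  + by move=> x; rewrite in_itv /= => /andP[x0 _]; apply: dgP; lra.
  + apply: continuous_in_subspaceT => x /set_mem /=; rewrite in_itv /= => /andP[x0 _].
    by apply: cg; lra.
  rewrite in_itv /= => /andP[cy c0]; rewrite g0 !sub0r => gE.
  have -> : g y = dg c * y by lra.
  have -> : dg c * y = (- c) ^+ 3 / (1 + c) * - y by rewrite /dg; field; lra.
  rewrite mulr_ge0 //; last lra.
  by rewrite divr_ge0 ?exprn_ge0 //; lra.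
Qed.

Lemma ln1D_taylor (y : R) : `|y| <= 2^-1 ->
  `|ln (1 + y) - (y - y ^+ 2 / 2)| <= 4 * `|y| ^+ 3.
Proof.
move=> yh.
have [yl yu] : - 2^-1 <= y /\ y <= 2^-1 by move: yh; rewrite ler_norml => /andP.
have up := @ln1D_le y ltac:(lra).
have lo : y - y ^+ 2 / 2 - 4 * `|y| ^+ 3 <= ln (1 + y).
  (* Since 1 + w is the inverse of 1 + y, the upper bound at w is a lower bound at y. *)
  pose w := - y / (1 + y).
  have wE : 1 + w = (1 + y)^-1 by rewrite /w; field; lra.
  have w1 : -1 < w.
    have : 0 < (1 + y)^-1 by rewrite invr_gt0; lra.
    rewrite -wE; lra.
  have := ln1D_le w1; rewrite wE lnV ?posrE; last lra.
  suff : w - w ^+ 2 / 2 + w ^+ 3 / 3 <= - (y - y ^+ 2 / 2 - 4 * `|y| ^+ 3) by lra.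
  pose q := (3^-1 + y / 2 + y ^+ 2 / 2) / (1 + y) ^+ 3.
  have -> : w - w ^+ 2 / 2 + w ^+ 3 / 3 = - y + y ^+ 2 / 2 - y ^+ 3 * q.
    by rewrite /w /q; field; lra.
  have c0 : 8^-1 <= (1 + y) ^+ 3.
    have -> : 8^-1 = 2^-1 ^+ 3 :> R by field.
    by apply: lerXn2r; rewrite ?nnegrE; lra.
  have q0 : 0 <= q by rewrite divr_ge0 //; nra.
  have q4 : y <= 0 -> q <= 4.
    by move=> y0; rewrite ler_pdivrMr; nra.
  suff : - y ^+ 3 * q <= 4 * `|y| ^+ 3 by lra.
  have [y0|y0] := leP 0 y.
    rewrite ger0_norm // (@le_trans _ _ 0) //; last by rewrite mulr_ge0 ?exprn_ge0.
    by rewrite mulNr oppr_le0 mulr_ge0 ?exprn_ge0.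
  rewrite ltr0_norm //.
  have -> : - y ^+ 3 = (- y) ^+ 3 by ring.
  rewrite mulrC ler_wpM2r ?exprn_ge0 ?q4 //; lra.
have y3 : y ^+ 3 / 3 <= 4 * `|y| ^+ 3.
  have : y ^+ 3 <= `|y| ^+ 3 by rewrite -normrX ler_norm.
  have : 0 <= `|y| ^+ 3 by rewrite exprn_ge0.
  lra.
by rewrite ler_norml; apply/andP; split; lra.
Qed.

End LogTaylor.

(** * Moduli and mean values on circles *)

Section Circle.
Variable R : realType.

(** For c = cos th this expands log |1 + w|, w = rho e^{i th}, to second order as the real part of w
    - w^2 / 2; note that 1 - 2 c^2 = - cos 2 th. *)
Lemma log_circle (rho c : R) : `|rho| <= 8^-1 -> `|c| <= 1 ->
  `|ln (1 + 2 * rho * c + rho ^+ 2) / 2 - (rho * c + rho ^+ 2 * (1 - 2 * c ^+ 2) / 2)|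
  <= 60 * `|rho| ^+ 3.
Proof.
move=> rho8 c1.
pose y := 2 * rho * c + rho ^+ 2; pose a := `|rho|.
have a0 : 0 <= a by exact: normr_ge0.
have a1 : a <= 1 by move: rho8; rewrite -/a; lra.
have y3 : `|y| <= 3 * a.
  apply: le_trans (ler_normD _ _) _; rewrite normrX !normrM -/a gtr0_norm //.
  have : a * `|c| <= a by rewrite ler_piMr.
  have : a ^+ 2 <= a by rewrite expr2 ler_piMr.
  lra.
have := @ln1D_taylor R y; rewrite addrA -/a => /(_ _).
have yh : `|y| <= 2^-1 by apply: le_trans y3 _; move: rho8; rewrite -/a; lra.
move=> /(_ yh) T.
have yc : `|y| ^+ 3 <= 27 * a ^+ 3.
  have -> : 27 * a ^+ 3 = (3 * a) ^+ 3 by ring.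
  by rewrite lerXn2r ?nnegrE ?mulr_ge0.
set L := ln _ in T *.
have -> : L / 2 - (rho * c + rho ^+ 2 * (1 - 2 * c ^+ 2) / 2) =
   (L - (y - y ^+ 2 / 2)) / 2 - rho ^+ 2 * (rho * c + rho ^+ 2 / 4).
  by rewrite /y; field.
apply: le_trans (ler_normB _ _) _.
have -> : `|(L - (y - y ^+ 2 / 2)) / 2| = `|L - (y - y ^+ 2 / 2)| / 2.
  by rewrite normrM [X in _ * X]gtr0_norm // invr_gt0.
have : `|rho ^+ 2 * (rho * c + rho ^+ 2 / 4)| <= 2 * a ^+ 3.
  rewrite normrM normrX -/a.
  have -> : 2 * a ^+ 3 = a ^+ 2 * (2 * a) by ring.
  rewrite ler_wpM2l ?exprn_ge0 //.
  apply: le_trans (ler_normD _ _) _; rewrite normrM [`|_ ^+ 2 / 4|]normrM normrX -/a (@gtr0_norm _ 4^-1) ?invr_gt0 //.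
  have : a * `|c| <= a by rewrite ler_piMr.
  have : a ^+ 2 <= a by rewrite expr2 ler_piMr.
  lra.
have : 0 <= a ^+ 3 by rewrite exprn_ge0.
lra.
Qed.

Lemma integral_trig (A B C : R) :
  (\int[@lebesgue_measure R]_(t in `[0%R, (2 * pi)%R]%classic)
     (A + B * cos t + C * cos t ^+ 2)%:E = (2 * pi * (A + C / 2))%:E)%E.
Proof.
pose F (t : R) := A * t + B * sin t + C / 2 * (t + sin t * cos t).
have dF (t : R) : is_derive t 1 F (A + B * cos t + C * cos t ^+ 2).
  have ds := is_derive_sin t; have dc := is_derive_cos t.
  have dt : is_derive t 1 (fun t : R => t) 1 by exact: is_derive_id.
  have dsc := is_deriveM ds dc.
  have H := is_deriveD (is_deriveD (is_deriveZ A dt) (is_deriveZ B ds))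
    (is_deriveZ (C / 2) (is_deriveD dt dsc)).
  apply: is_derive_eq H _.
  rewrite -![_ *: _]/(_ * _) /=.
  have -> : sin t * - sin t = cos t ^+ 2 - 1 by have := cos2Dsin2 t; lra.
  by field.
have cF (t : R) : {for t, continuous F}.
  by have [/derivable1_diffP /differentiable_continuous] := dF t.
rewrite (@continuous_FTC2 _ _ F) //.
- rewrite -EFinB /F mulr_natl sin2pi sin0; congr (_%:E); by field.
- by rewrite mulr_gt0 // pi_gt0.
- apply: continuous_subspaceT => t.
  apply: cvgD; last by apply: cvgM; [exact: cvg_cst|apply: cvgM; exact: continuous_cos].
  by apply: cvgD; [exact: cvg_cst|apply: cvgM; [exact: cvg_cst|exact: continuous_cos]].
- split.
  + by move=> x _; have [] := dF x.
  + by apply: cvg_at_right_filter; apply: cF.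
  + by apply: cvg_at_left_filter; apply: cF.
- by move=> x _; rewrite derive1E; have [_ ->] := dF x.
Qed.

(** Second order expansions in e^{i t} of functions of moduli are quadratic in cos t, and the mean
    of such a majorant is explicit. With B = C = 0 this is a maximum principle on the circle. *)
Lemma psh_trig_mean n (u : Cn R n -> \bar R) (a b : Cn R n) (A B C : R) :
  psh u ->
  (forall t, (u (fun k => (a k + Complex (cos t) (sin t) * b k)%R) <=
     (A + B * cos t + C * cos t ^+ 2)%:E)%E) ->
  (u a <= (A + C / 2)%:E)%E.
Proof.
move=> [_ _ _ /(_ a b) uab] ule; apply: (le_trans uab).
have p0 : 0 < 2 * pi :> R by rewrite mulr_gt0 // pi_gt0.
have -> : A + C / 2 = (2 * pi)^-1 * (2 * pi * (A + C / 2)).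
  by rewrite mulKf // gt_eqF.
rewrite EFinM lee_pmul2l //; last by rewrite lte_fin invr_gt0.
rewrite -(integral_trig A B C).
by apply: le_integral_pointwise => t _; exact: ule.
Qed.

Lemma cabs_ge0 (z : R[i]) : 0 <= cabs z.
Proof. exact: sqrtr_ge0. Qed.

Lemma normc_cabs (z : R[i]) : `|z| = Complex (cabs z) 0.
Proof. exact: normc_def. Qed.

Lemma cabsM (z w : R[i]) : cabs (z * w) = cabs z * cabs w.
Proof.
by have := normrM z w; rewrite !normc_cabs => /(congr1 (@complex.Re R)) /= ->; ring.
Qed.

Lemma cabsD (z w : R[i]) : cabs (z + w) <= cabs z + cabs w.
Proof.
have := ler_normD z w; rewrite !normc_cabs.
by rewrite lecE /= => /andP[].
Qed.

Lemma cabsN (z : R[i]) : cabs (- z) = cabs z.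
Proof. by have := normrN z; rewrite !normc_cabs => /(congr1 (@complex.Re R)). Qed.

Lemma cabs_eq0 (z : R[i]) : (cabs z == 0) = (z == 0).
Proof. by rewrite -[RHS](normr_eq0 z) normc_cabs eq_complex /= eqxx andbT. Qed.

Lemma cabs_gt0 (z : R[i]) : (0 < cabs z) = (z != 0).
Proof. by rewrite lt_neqAle cabs_ge0 andbT eq_sym cabs_eq0. Qed.

Lemma cabsX (z : R[i]) m : cabs (z ^+ m) = cabs z ^+ m.
Proof.
elim: m => [|m IH]; last by rewrite !exprS cabsM IH.
by rewrite !expr0 /cabs /= expr1n expr0n addr0 sqrtr1.
Qed.

Lemma cabs_real (x : R) : cabs (Complex x 0) = `|x|.
Proof. by rewrite /cabs /= expr0n addr0 sqrtr_sqr. Qed.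

Lemma cabs_prod n (f : 'I_n -> R[i]) : cabs (\prod_k f k) = \prod_k cabs (f k).
Proof.
elim/big_ind2 : _ => // [|x1 x2 y1 y2 <- <-]; last exact: cabsM.
by rewrite -[1]/(Complex 1 0) cabs_real normr1.
Qed.

Lemma cabs_sum_le (I : finType) (P : pred I) (f : I -> R[i]) :
  cabs (\sum_(i | P i) f i) <= \sum_(i | P i) cabs (f i).
Proof.
elim/big_ind2 : _ => // [|x1 x2 y1 y2 h1 h2].
  by rewrite -[0]/(Complex 0 0) cabs_real normr0.
by apply: le_trans (cabsD _ _) _; exact: lerD.
Qed.

Lemma cabs_circle (rho t : R) :
  cabs (1 + Complex (cos t) (sin t) * Complex rho 0) =
  Num.sqrt (1 + 2 * rho * cos t + rho ^+ 2).
Proof.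
rewrite /cabs /=; congr Num.sqrt.
have -> : rho ^+ 2 = rho ^+ 2 * (cos t ^+ 2 + sin t ^+ 2) by rewrite cos2Dsin2 mulr1.
by ring.
Qed.

End Circle.

Lemma continuous_sum (R : realType) (T : topologicalType) (I : Type) (s : seq I)
    (f : I -> T -> R) x : (forall i, {for x, continuous (f i)}) ->
  {for x, continuous (fun z => \sum_(i <- s) f i z)}.
Proof.
move=> cf; elim: s => [|i s IH].
  by rewrite (_ : (fun _ => _) = cst 0);
    [exact: cst_continuous|apply/funext => z; rewrite big_nil].
rewrite (_ : (fun _ => _) = (fun z => f i z + \sum_(j <- s) f j z)).
  by apply: cvgD; [exact: cf|exact: IH].
by apply/funext => z; rewrite big_cons.
Qed.

(** * Convexity in logarithmic coordinates *)

Section Convexity.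
Variables (R : realType) (n : nat).
Implicit Types (t x y p d : 'rV[R]_n) (u : Cn R n -> \bar R).

Definition expv t : Cn R n := fun k => Complex (expR (t ord0 k)) 0.

Lemma cabs_expv t k : cabs (expv t k) = expR (t ord0 k).
Proof. by rewrite cabs_real gtr0_norm // expR_gt0. Qed.

Lemma usc_expv u t (c : R) : usc u -> (u (expv t) < c%:E)%E ->
  \forall t' \near t, (u (expv t') < c%:E)%E.
Proof.
move=> uscu /uscu [d d0 ud].
have : \forall t' \near t, forall k : 'I_n, cabs (expv t' k - expv t k) < d.
  have H k : \forall t' \near t, cabs (expv t' k - expv t k) < d.
    have : (fun t' : 'rV[R]_n => expR (t' ord0 k)) @ t --> expR (t ord0 k).
      apply: (continuous_comp (f := fun t' : 'rV[R]_n => t' ord0 k)).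
        exact: coord_continuous.
      exact: continuous_expR.
    move=> /cvgrPdist_lt /(_ _ d0); apply: filterS => t'.
    by rewrite distrC -[expv t' k - expv t k]/(Complex _ (0 - 0)) subr0 cabs_real.
  exact: filter_forall H.
by apply: filterS => t'; exact: ud.
Qed.

(** This is log |1 + rho e^{i th}| for c = cos th, the change of one logarithmic coordinate along a
    circle. *)
Definition log_shift (rho c : R) : R := ln (1 + 2 * rho * c + rho ^+ 2) / 2.

(** The circle is e^{t_k} (1 + p_k e^{i th}); u sees only the moduli of its points. The bound 1/8
    keeps it away from the coordinate hyperplanes, so that the logarithms make sense. *)
Lemma psh_toric_mean u t p (A B C : R) : psh u -> toric u ->
  (forall k, `|p ord0 k| <= 8^-1) ->
  (forall c, `|c| <= 1 -> (u (expv (t + \row_k log_shift (p ord0 k) c)) <=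
     (A + B * c + C * c ^+ 2)%:E)%E) ->
  (u (expv t) <= (A + C / 2)%:E)%E.
Proof.
move=> pshu toru p8 ule.
apply: (@psh_trig_mean _ _ u (expv t) (fun k => expv t k * Complex (p ord0 k) 0) A B C pshu).
move=> th; have c1 : `|cos th| <= 1 by rewrite ler_norml cos_geN1 cos_le1.
apply: le_trans (ule _ c1); rewrite le_eqVlt; apply/orP; left; apply/eqP.
apply: toru => k.
rewrite cabs_expv !mxE.
have -> : expv t k + Complex (cos th) (sin th) * (expv t k * Complex (p ord0 k) 0) =
    expv t k * (1 + Complex (cos th) (sin th) * Complex (p ord0 k) 0) by ring.
rewrite cabsM cabs_expv cabs_circle expRD; congr (_ * _).
set w := 1 + _ + _.
have w0 : 0 < w.
  rewrite /w; have := p8 k; have := c1; rewrite !ler_norml => /andP[? ?] /andP[? ?].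
  nra.
rewrite /log_shift -/w -[w in LHS]lnK ?posrE // -[expR (_ / 2)]ger0_norm ?expR_ge0 //.
rewrite -sqrtr_sqr -expRM_natl; congr (Num.sqrt (expR _)); by field.
Qed.

Lemma usc_near_box u t (c : R) : usc u -> (u (expv t) < c%:E)%E ->
  exists2 del : R, 0 < del & forall d, (forall k, `|d ord0 k| <= del) ->
    (u (expv (t + d)) < c%:E)%E.
Proof.
move=> uscu /(usc_expv uscu) /nbhs_ballP [e /= e0 et].
exists (e / 2) => [|d dle]; first by rewrite divr_gt0.
apply: et; split => // i j; rewrite ord1 /ball /= mxE opprD addNKr normrN.
by apply: le_lt_trans (dle j) _; rewrite ltr_pdivrMr // ltr_pMr // ltr1n.
Qed.

(* If convexity fails on [x, y], maximize u minus an affine function of s, minus a small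
   strictly concave function of s and a large multiple of |d|^2 over the points
   x + s (y - x) + d of a thin tube.  The maximum is interior, and along the circle
   e^{t_k} (1 + r p_k e^{i th}) through it the second order terms contradict the mean
   value inequality. *)
Lemma psh_toric_convex u x y (a b l : R) : psh u -> toric u ->
  (u (expv x) < a%:E)%E -> (u (expv y) < b%:E)%E -> 0 < l < 1 ->
  (u (expv ((1 - l) *: x + l *: y)) <= ((1 - l) * a + l * b)%:E)%E.
Proof.
move=> pshu toru ux uy /andP[l0 l1].
have [ufin uscu _ _] := pshu.
rewrite leNgt; apply/negP => gt.
pose p := y - x.
have [dx dx0 bx] := usc_near_box uscu ux.
have [dy dy0 by_] := usc_near_box uscu uy.
pose del := Num.min 1 (Num.min dx dy).
have del0 : 0 < del by rewrite !lt_min dx0 dy0 ltr01.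
have del1 : del <= 1 by rewrite !ge_min lexx.
have delx : del <= dx by rewrite !ge_min lexx !orbT.
have dely : del <= dy by rewrite !ge_min lexx !orbT.
pose K : set (R * 'rV[R]_n)%type := (`[0, 1]%classic : set R) `*`
  [set d : 'rV[R]_n | forall k : 'I_n, (`[- del, del]%classic : set R) (d ord0 k)].
have cK : compact K.
  apply: compact_setX; first exact: segment_compact.
  by apply: (@rV_compact _ _ (fun=> `[- del, del]%classic)) => _; exact: segment_compact.
have KP z : K z <-> (0 <= z.1 <= 1) /\ (forall k, `|z.2 ord0 k| <= del).
  rewrite /K /setX /= in_itv /=; split=> -[z1 z2]; split=> // k.
    by have := z2 k; rewrite in_itv /= ler_norml.
  by rewrite in_itv /= -ler_norml.
pose pt (z : R * 'rV[R]_n) := x + z.1 *: p + z.2.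
have cpt : continuous pt.
  move=> z; apply: cvgD; last exact: cvg_snd.
  by apply: cvgD; [exact: cvg_cst|apply: cvgZl; exact: cvg_fst].
have uscpt z (c : R) : (u (expv (pt z)) < c%:E)%E ->
    \forall z' \near z, (u (expv (pt z')) < c%:E)%E.
  by move=> /(usc_expv uscu) H; exact: (cpt z _ H).
have K0 : K (l, 0).
  by apply/KP; rewrite /= !ltW //; split=> // k; rewrite mxE normr0 ltW.
have [Bd uBd] : exists Bd : R, forall z, K z -> (u (expv (pt z)) < Bd%:E)%E.
  have [] := @usc_compact_max R _ K (fun z => u (expv (pt z))) cK.
  - by exists (l, 0).
  - by move=> *; exact: ufin.
  - by move=> z c _; exact: uscpt.
  move=> z _ zmax.
  have [B uB] : exists B : R, (u (expv (pt z)) < B%:E)%E.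
    have := ufin (expv (pt z)); case: (u _) => [r _|//|_].
    - by exists (r + 1); rewrite lte_fin ltrDl.
    - by exists 0; rewrite ltNyr.
  by exists B => z' /zmax /le_lt_trans; apply.
have ptl : pt (l, 0) = (1 - l) *: x + l *: y.
  by apply/rowP => k; rewrite !mxE /=; ring.
rewrite -ptl in gt.
have [rl url] : exists r : R, u (expv (pt (l, 0))) = r%:E.
  by move: gt (ufin (expv (pt (l, 0)))); case: (u _) => [r _ _|//|//]; exists r.
move: gt; rewrite url lte_fin => gt.
pose eta := rl - ((1 - l) * a + l * b).
have eta0 : 0 < eta by rewrite subr_gt0.
(* On the sides of the tube the penalty M |d|^2 is then at least |Bd| + |a| + |b| + 1, which makes h
   exceed the bound [Bd] of u: the maximum is not reached there. *)
pose M := (`|Bd| + `|a| + `|b| + 1) / del ^+ 2.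
have M0 : 0 < M.
  by rewrite divr_gt0 ?exprn_gt0 // ltr_wpDl // !addr_ge0.
pose h (z : R * 'rV[R]_n) := (1 - z.1) * a + z.1 * b + eta * (z.1 * (1 - z.1)) +
   M * \sum_k z.2 ord0 k ^+ 2.
have ch : continuous h.
  move=> z.
  have c1 : (fun z : R * 'rV[R]_n => z.1) @ z --> z.1 by exact: cvg_fst.
  have c2 : (fun z : R * 'rV[R]_n => 1 - z.1) @ z --> 1 - z.1.
    by apply: cvgB => //; exact: cvg_cst.
  apply: cvgD; last first.
    apply: cvgM; first exact: cvg_cst.
    apply: (@continuous_sum _ _ _ _ (fun k (z : R * 'rV[R]_n) => z.2 ord0 k ^+ 2)) => k.
    have ck : {for z, continuous (fun z : R * 'rV[R]_n => z.2 ord0 k)}.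
      apply: (@continuous_comp _ _ _ snd (fun v : 'rV[R]_n => v ord0 k)).
        exact: cvg_snd.
      exact: coord_continuous.
    exact: (cvgM ck ck).
  apply: cvgD; last by apply: cvgM; [exact: cvg_cst|exact: cvgM].
  by apply: cvgD; apply: cvgM => //; exact: cvg_cst.
pose f (z : R * 'rV[R]_n) := (u (expv (pt z)) - (h z)%:E)%E.
have [||z c Kz|z0 Kz0 zmax] := @usc_compact_max R _ K f cK.
- by exists (l, 0).
- by move=> z _; rewrite /f lteBlDr // ?ufin // addye.
- rewrite /f lteBlDr // -EFinD => lt1.
  have [c' uc' c'lt] : exists2 c' : R, (u (expv (pt z)) < c'%:E)%E & c' < c + h z.
    move: lt1; case: (u _) => [r|//|_].
    - by rewrite lte_fin => rs; exists ((r + (c + h z)) / 2); rewrite ?lte_fin midf_lt.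
    - by exists (c + h z - 1); rewrite ?ltNyr // ltrBlDr ltrDl.
  have H1 := uscpt _ _ uc'.
  have H2 : \forall z' \near z, c' - c < h z'.
    by move: (ch z) => /cvgr_gt; apply; rewrite ltrBlDl.
  apply: filterS2 H1 H2 => z' h1 h2; rewrite lteBlDr // -EFinD.
  by apply: (lt_trans h1); rewrite lte_fin -ltrBlDl.
(* The value is eta (1 - l (1 - l)). Hence the maximum of f is positive, which also excludes the two
   ends of the tube. *)
have fl : (0 < f (l, 0%R))%E.
  rewrite /f url -EFinB lte_fin /h /=.
  rewrite (eq_bigr (fun=> 0)) => [|k _]; last by rewrite mxE expr0n.
  rewrite big1 // mulr0 addr0.
  by have := eta0; rewrite /eta; nra.
have := lt_le_trans fl (zmax _ K0).
have [m um] : exists m, u (expv (pt z0)) = (m + h z0)%:E.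
  have := lt_le_trans fl (zmax _ K0); rewrite /f; have := ufin (expv (pt z0)).
  by case: (u _) => [r _ _|//|//]; exists (r - h z0); rewrite subrK.
have fz0 : f z0 = m%:E by rewrite /f um -EFinB addrK.
rewrite fz0 lte_fin => m0.
have ule z : K z -> (u (expv (pt z)) <= (m + h z)%:E)%E.
  by move=> /zmax; rewrite fz0 /f leeBlDr // -EFinD.
have [/andP[s00 s01] d0del] := (KP z0).1 Kz0.
case: z0 => s0 d0 in Kz0 zmax um fz0 s00 s01 d0del.
rewrite /= in s00 s01 d0del.
have umh : (u (expv (pt (s0, d0))) > (h (s0, d0))%:E)%E.
  by rewrite um lte_fin ltrDr.
have S0 : 0 <= \sum_k d0 ord0 k ^+ 2 by apply: sumr_ge0 => k _; exact: sqr_ge0.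
have s0gt : 0 < s0.
  rewrite lt_neqAle s00 andbT; apply/eqP => s0E.
  move: umh; rewrite ltNge => /negP; apply; apply: ltW.
  rewrite -s0E /pt /= scale0r addr0.
  apply: (lt_le_trans (bx d0 _)) => [k|]; first exact: le_trans (d0del k) delx.
  by rewrite lee_fin /h /= subr0 mul1r !mul0r mulr0 !addr0 lerDl mulr_ge0 // ltW.
have s0lt : s0 < 1.
  rewrite lt_neqAle s01 andbT; apply/eqP => s0E.
  move: umh; rewrite ltNge => /negP; apply; apply: ltW.
  have -> : pt (s0, d0) = y + d0.
    by apply/rowP => k; rewrite s0E /pt /p !mxE /=; ring.
  apply: (lt_le_trans (by_ d0 _)) => [k|]; first exact: le_trans (d0del k) dely.
  by rewrite lee_fin /h /= s0E subrr mul0r mul1r !mulr0 add0r addr0 lerDl mulr_ge0 // ltW.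
have d0lt k : `|d0 ord0 k| < del.
  rewrite lt_neqAle d0del andbT; apply/eqP => d0E.
  move: umh; rewrite ltNge => /negP; apply; apply: ltW.
  apply: (lt_le_trans (uBd _ Kz0)); rewrite lee_fin.
  have Mdel : M * del ^+ 2 = `|Bd| + `|a| + `|b| + 1.
    by rewrite /M divfK // gt_eqF // exprn_gt0.
  have : M * del ^+ 2 <= M * \sum_k d0 ord0 k ^+ 2.
    rewrite ler_pM2l // (bigD1 k) //= -[d0 ord0 k ^+ 2]ger0_norm ?sqr_ge0 // normrX d0E.
    by rewrite lerDl sumr_ge0 // => j _; exact: sqr_ge0.
  rewrite Mdel /h /= => HM.
  have h1 : - `|a| <= (1 - s0) * a.
    rewrite -[leLHS]mul1r; have := ler_norm (- a); rewrite normrN; have := normr_ge0 a; nra.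
  have h2 : - `|b| <= s0 * b.
    rewrite -[leLHS]mul1r; have := ler_norm (- b); rewrite normrN; have := normr_ge0 b; nra.
  have h3 : 0 <= eta * (s0 * (1 - s0)) by rewrite !mulr_ge0 // ?subr_ge0 ltW.
  have := ler_norm Bd; lra.
pose D := \sum_k `|p ord0 k| ^+ 3.
have D0 : 0 <= D by apply: sumr_ge0 => k _; rewrite exprn_ge0.
have small (c e : R) : 0 < e -> 0 <= c -> \forall r \near 0^'+, r * c < e.
  move=> e0 c0; near=> r.
  have r0 : 0 <= r by near: r; exact: nbhs_right_ge.
  apply: (@le_lt_trans _ _ (r * (c + 1))); first by rewrite ler_wpM2l // lerDl.
  rewrite -ltr_pdivlMr ?ltr_wpDl //.
  by near: r; apply: nbhs_right_lt; rewrite divr_gt0 // ltr_wpDl.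
have [r [[r0 [rs0 rs1]] [rp rd rD]]] : exists r : R, (0 < r /\ (r * 1 < s0 /\ r * 1 < 1 - s0)) /\
  [/\ forall k, r * `|p ord0 k| < 8^-1, forall k, r * `|p ord0 k| < del - `|d0 ord0 k| &
      r * (128 * M * D) < eta / 2].
  have /filter_ex [r Hr] : \forall r \near 0^'+, (0 < r /\ (r * 1 < s0 /\ r * 1 < 1 - s0)) /\
  [/\ forall k, r * `|p ord0 k| < 8^-1, forall k, r * `|p ord0 k| < del - `|d0 ord0 k| &
      r * (128 * M * D) < eta / 2].
    near=> r; split.
      split; first by near: r; exact: nbhs_right_gt.
      split; near: r; apply: small; rewrite ?subr_gt0 //.
    split.
    - near: r; apply: filter_forall => k; apply: small => //; rewrite invr_gt0.
    - by near: r; apply: filter_forall => k; apply: small => //; rewrite subr_gt0.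
    - near: r; apply: small; first by rewrite divr_gt0.
      by rewrite mulr_ge0 // mulr_ge0 // ltW.
  by exists r.
rewrite !mulr1 in rs0 rs1.
(* A + B c + C c^2 will majorize m + h along the circle. In the mean A + C / 2 the terms in Q
   cancel, 1 - 2 cos^2 having mean 0; what remains beyond m + h is - eta r^2 / 2 and a cubic error.
   In that error 128 = 2 * 60 + 8: twice 60 for the cross term d0 e, and 8 for e^2. *)
pose Q := \sum_k d0 ord0 k * p ord0 k ^+ 2.
pose A := m + h (s0, d0) + M * r ^+ 2 * Q + M * (128 * r ^+ 3 * D).
pose B := r * (b - a) + eta * (1 - 2 * s0) * r.
pose C := - eta * r ^+ 2 - 2 * M * r ^+ 2 * Q.
suff : (u (expv (pt (s0, d0))) <= (A + C / 2)%:E)%E.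
  rewrite um lee_fin; apply/negP; rewrite -ltNge.
  have -> : A + C / 2 = m + h (s0, d0) + r ^+ 2 * (r * (128 * M * D) - eta / 2).
    by rewrite /A /C; field.
  by rewrite gtrDl pmulr_rlt0 ?exprn_gt0 // subr_lt0.
have rp8 k : `|(r *: p) ord0 k| <= 8^-1 by rewrite mxE normrM gtr0_norm // ltW.
apply: (@psh_toric_mean u _ (r *: p) A B C pshu toru rp8) => c c1.
(* The first order part of the shift is along p and is absorbed by moving s0 to s0 + r c; the rest,
   e, is of order r^2. *)
pose e := \row_k (log_shift ((r *: p) ord0 k) c - r * p ord0 k * c) : 'rV[R]_n.
have -> : pt (s0, d0) + \row_k log_shift ((r *: p) ord0 k) c = pt (s0 + r * c, d0 + e).
  by apply/rowP => k; rewrite !mxE /=; ring.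
have [cl cu] : -1 <= c /\ c <= 1 by move: c1; rewrite ler_norml => /andP.
have c2 : c ^+ 2 <= 1 by rewrite expr2; nra.
have eP k : `|e ord0 k - (r * p ord0 k) ^+ 2 * (1 - 2 * c ^+ 2) / 2| <= 60 * (r * `|p ord0 k|) ^+ 3.
  have := log_circle (rp8 k) c1; rewrite !mxE !normrM (gtr0_norm r0).
  by apply: le_trans; rewrite le_eqVlt; apply/orP; left; apply/eqP; congr `|_|; rewrite /log_shift; ring.
have sqE k : (r * p ord0 k) ^+ 2 = (r * `|p ord0 k|) ^+ 2.
  by rewrite !exprMn -normrX [`|_ ^+ 2|]ger0_norm // sqr_ge0.
have e8 k : `|e ord0 k| <= 8 * (r * `|p ord0 k|) ^+ 2.
  have := eP k; rewrite sqE; have := ltW (rp k).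
  have : 0 <= r * `|p ord0 k| by rewrite mulr_ge0 // ltW.
  move: (r * _) => w w0 w8; rewrite ler_distl => /andP[el eu].
  have ww : w ^+ 3 <= w ^+ 2 / 8.
    have -> : w ^+ 3 = w ^+ 2 * w by ring.
    by rewrite ler_wpM2l // sqr_ge0.
  have w20 : 0 <= w ^+ 2 by exact: sqr_ge0.
  have : `|w ^+ 2 * (1 - 2 * c ^+ 2) / 2| <= w ^+ 2 / 2.
    rewrite normrM [X in _ * X <= _]gtr0_norm ?invr_gt0 // ler_wpM2r ?invr_ge0 //.
    rewrite normrM (ger0_norm w20) ler_piMr // ler_norml.
    by have := sqr_ge0 c; lra.
  by rewrite !ler_norml => /andP[? ?]; apply/andP; split; lra.
apply: le_trans (ule _ _) _.
  apply/KP => /=; split.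
    have : `|r * c| <= r by rewrite normrM gtr0_norm // ler_piMr // ltW.
    by rewrite ler_norml => /andP[? ?]; apply/andP; split; lra.
  move=> k; rewrite mxE; apply: le_trans (ler_normD _ _) _.
  have := rd k; have := rp k; have := e8 k.
  have : 0 <= r * `|p ord0 k| by rewrite mulr_ge0 // ltW.
  move: (r * _) => w w0 ew w8 wd.
  have : w ^+ 2 <= w / 8 by rewrite expr2 ler_wpM2l // ltW.
  by lra.
rewrite lee_fin.
have sumle : \sum_k (d0 + e) ord0 k ^+ 2 <= \sum_k d0 ord0 k ^+ 2 +
    r ^+ 2 * (1 - 2 * c ^+ 2) * Q + 128 * r ^+ 3 * D.
  rewrite /Q /D !mulr_sumr -!big_split /=; apply: ler_sum => k _.
  rewrite mxE; have := eP k; have := e8 k; have := sqE k.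
  have := ltW (rp k); have := le_trans (d0del k) del1.
  have : 0 <= r * `|p ord0 k| by rewrite mulr_ge0 // ltW.
  have -> : r ^+ 2 * (1 - 2 * c ^+ 2) * (d0 ord0 k * p ord0 k ^+ 2) =
     d0 ord0 k * ((r * p ord0 k) ^+ 2 * (1 - 2 * c ^+ 2)) by ring.
  have -> : 128 * r ^+ 3 * `|p ord0 k| ^+ 3 = 128 * (r * `|p ord0 k|) ^+ 3 by ring.
  move: (r * `|p ord0 k|) (r * p ord0 k) (e ord0 k) (d0 ord0 k) => w v ek dk w0 dk1 w8 -> ek8 ekP.
  set g := w ^+ 2 * (1 - 2 * c ^+ 2) in ekP *.
  have E2 : ek ^+ 2 <= 8 * w ^+ 3.
    have : `|ek| ^+ 2 <= (8 * w ^+ 2) ^+ 2 by rewrite lerXn2r ?nnegrE // mulr_ge0 // sqr_ge0.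
    rewrite -normrX ger0_norm ?sqr_ge0 // => /le_trans; apply.
    have -> : (8 * w ^+ 2) ^+ 2 = (8 * w ^+ 3) * (8 * w) by ring.
    by rewrite ler_piMr ?mulr_ge0 ?exprn_ge0 //; lra.
  have E1 : dk * (ek - g / 2) <= 60 * w ^+ 3.
    apply: le_trans (ler_norm _) _; rewrite normrM.
    by apply: le_trans ekP; rewrite ler_piMl.
  have -> : (dk + ek) ^+ 2 = dk ^+ 2 + dk * g + 2 * (dk * (ek - g / 2)) + ek ^+ 2 by field.
  lra.
have := ler_wpM2l (ltW M0) sumle.
rewrite /A /B /C /h /=; lra.
Unshelve. all: by end_near.
Qed.

End Convexity.

(** * The convex potential of u on the torus *)

Section ToricPotential.
Variables (R : realType) (n : nat) (u : Cn R n -> \bar R).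
Implicit Types (t x y : 'rV[R]_n) (z : Cn R n).

Lemma cabs_le_cnorm z k : cabs (z k) <= cnorm z.
Proof.
rewrite /cnorm -[cabs (z k)]ger0_norm ?cabs_ge0 // -sqrtr_sqr ler_wsqrtr //.
by rewrite (bigD1 k) //= lerDl sumr_ge0 // => j _; exact: sqr_ge0.
Qed.

Definition lnv z : 'rV[R]_n := \row_k ln (cabs (z k)).

Lemma toric_torus z : toric u -> (forall k, z k != 0) -> u z = u (expv (lnv z)).
Proof.
move=> toru z0; apply: toru => k.
by rewrite cabs_expv mxE lnK // posrE cabs_gt0.
Qed.

Hypotheses (n0 : (0 < n)%N) (Lu : LPSHstar u) (toru : toric u).

Definition phi t : R := fine (u (expv t)).

Let pshu : psh u. Proof. by case: Lu => -[]. Qed.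

Lemma u_pos_far : exists T : R, forall t k, T < t ord0 k -> (0 < u (expv t))%E.
Proof.
have [_ /(_ 0) [r ur]] := Lu.
exists (ln (Num.max r 1)) => t k Tt; apply: ur.
apply: lt_le_trans (cabs_le_cnorm _ k); rewrite cabs_expv.
apply: (@le_lt_trans _ _ (Num.max r 1)); first by rewrite le_max lexx.
by rewrite -[ltLHS]lnK ?posrE ?ltr_expR // lt_max ltr01 orbT.
Qed.

(** If u were -oo at t, it would be below - b there, where b bounds u at a far point y. Convexity
    then gives u <= 0 at the midpoint, although it lies far enough for u to be positive. *)
Lemma u_expvE t : u (expv t) = (phi t)%:E.
Proof.
rewrite /phi fineK // fin_numE; have [ufin _ _ _] := pshu.
rewrite andbC lt_eqF ?ufin //=; apply/eqP => uty.
have [T uT] := u_pos_far; pose k0 := Ordinal n0.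
pose s := `|T| + `|t ord0 k0| + 1.
pose y := t + const_mx (2 * s).
have [b ub] : exists b : R, (u (expv y) < b%:E)%E.
  have := ufin (expv y); case: (u _) => [r _|//|_].
  - by exists (r + 1); rewrite lte_fin ltrDl.
  - by exists 0; rewrite ltNyr.
have h : 0 < (2^-1 : R) < 1 by rewrite invr_gt0 ltr0n invf_lt1 // ltr1n.
have utb : (u (expv t) < (- b)%:E)%E by rewrite uty ltNyr.
have := psh_toric_convex pshu toru utb ub h.
have -> : (1 - 2^-1) * - b + 2^-1 * b = 0 by field.
rewrite leNgt => /negP; apply.
apply: (uT _ k0); rewrite !mxE.
have -> : (1 - 2^-1) * t ord0 k0 + 2^-1 * (t ord0 k0 + 2 * s) = t ord0 k0 + s by field.
have := ler_norm T; have := ler_norm (- t ord0 k0); rewrite normrN /s; lra.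
Qed.

Lemma phi_convex x y (l : R) : 0 <= l <= 1 ->
  phi ((1 - l) *: x + l *: y) <= (1 - l) * phi x + l * phi y.
Proof.
move=> /andP[]; rewrite le_eqVlt => /predU1P[<- _|l0].
  by rewrite subr0 !scale1r !scale0r mul1r mul0r !addr0.
rewrite le_eqVlt => /predU1P[->|l1].
  by rewrite subrr !scale1r !scale0r mul1r mul0r !add0r.
apply/ler_addgt0Pr => e e0.
have l01 : 0 < l < 1 by rewrite l0.
have lt1 t : (u (expv t) < (phi t + e)%:E)%E by rewrite u_expvE lte_fin ltrDl.
have := psh_toric_convex pshu toru (lt1 x) (lt1 y) l01.
rewrite u_expvE lee_fin; lra.
Qed.

Lemma phi_usc t (c : R) : phi t < c -> \forall t' \near t, phi t' < c.
Proof.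
move=> tc; have [_ uscu _ _] := pshu.
have : (u (expv t) < c%:E)%E by rewrite u_expvE lte_fin.
by move=> /(usc_expv uscu); apply: filterS => t'; rewrite u_expvE lte_fin.
Qed.

(* A convex function of s >= 0 bounded above at infinity is nonincreasing; along
   y + s (x - y) the points of the torus converge to a point of C^n, near which
   u is bounded above. *)
Lemma phi_mono x y : (forall k, x ord0 k <= y ord0 k) -> phi x <= phi y.
Proof.
move=> xy; have [ufin uscu _ _] := pshu.
pose zs : Cn R n := fun k => if x ord0 k == y ord0 k then expv y k else 0.
have [c uc] : exists c : R, (u zs < c%:E)%E.
  have := ufin zs; case: (u _) => [r _|//|_].
  - by exists (r + 1); rewrite lte_fin ltrDl.
  - by exists 0; rewrite ltNyr.
have [d d0 ud] := uscu _ _ uc.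
have near_s : \forall s \near +oo%R, phi (y + s *: (x - y)) < c.
  have : \forall s \near +oo%R, forall k, cabs (expv (y + s *: (x - y)) k - zs k) < d.
    have H k : \forall s \near +oo%R, cabs (expv (y + s *: (x - y)) k - zs k) < d.
      rewrite /zs; case: eqP => [xyk|/eqP xyk].
        near=> s; rewrite /expv !mxE xyk subrr mulr0 addr0 subrr.
        by rewrite -[0]/(Complex 0 0) cabs_real normr0.
      have lt_xy : 0 < y ord0 k - x ord0 k by rewrite subr_gt0 lt_neqAle xyk xy.
      near=> s; rewrite subr0 cabs_expv -[ltRHS]lnK ?posrE // ltr_expR !mxE.
      have : (y ord0 k - ln d) / (y ord0 k - x ord0 k) < s.
        by near: s; apply: nbhs_pinfty_gt; rewrite num_real.
      by rewrite ltr_pdivrMr //; lra.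
    exact: filter_forall H.
  by apply: filterS => s /ud; rewrite u_expvE lte_fin.
rewrite leNgt; apply/negP => lt_yx.
pose g := phi x - phi y; have g0 : 0 < g by rewrite subr_gt0.
have /filter_ex [s [h1 [s1 sg]]] : \forall s \near +oo%R,
    phi (y + s *: (x - y)) < c /\ (1 <= s /\ (c - phi y) / g < s).
  apply: filterI => //; apply: filterI; first by apply: nbhs_pinfty_ge; rewrite num_real.
  by apply: nbhs_pinfty_gt; rewrite num_real.
have s0 : 0 < s by lra.
  (* x is the point of parameter 1 / s between y and y + s (x - y). As (c - phi y) / s < g,
     convexity yields phi x < phi y + g, which is phi x itself. *)
  have l01 : 0 <= s^-1 <= 1 by rewrite invr_ge0 ltW // invf_le1.
  have := phi_convex y (y + s *: (x - y)) l01.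
  have -> : (1 - s^-1) *: y + s^-1 *: (y + s *: (x - y)) = x.
    by apply/rowP => k; rewrite !mxE; field; rewrite gt_eqF.
  move: sg; rewrite ltr_pdivrMr // => sg.
  have : s^-1 * phi (y + s *: (x - y)) <= s^-1 * c by rewrite ler_wpM2l ?invr_ge0 // ltW.
  have : s^-1 * (c - phi y) < g.
    by rewrite mulrC ltr_pdivrMr // mulrC.
  rewrite /g; lra.
Unshelve. all: by end_near. Qed.

(** Where z_k = 0, the mean value inequality is used on circles of radius e^{t_k}, along which u is
    constant by toricity. This reduces to points of the torus, where phi is monotone. *)
Lemma u_le_phi z t : (forall k, cabs (z k) <= expR (t ord0 k)) -> (u z <= (phi t)%:E)%E.
Proof.
move=> zt.
pose b : Cn R n := fun k => if z k == 0 then expv t k else 0.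
pose t' : 'rV[R]_n := \row_k if z k == 0 then t ord0 k else ln (cabs (z k)).
apply: (@le_trans _ _ (phi t')%:E).
  have -> : phi t' = phi t' + 0 / 2 by rewrite mul0r addr0.
  apply: (@psh_trig_mean _ _ u z b (phi t') 0 0 pshu) => th.
  rewrite !mul0r !addr0 -u_expvE le_eqVlt; apply/orP; left; apply/eqP.
  apply: toru => k; rewrite cabs_expv mxE /b.
  case: eqP => [->|/eqP zk].
    rewrite add0r cabsM cabs_expv {1}/cabs /= cos2Dsin2 sqrtr1 mul1r //.
  by rewrite mulr0 addr0 lnK // posrE cabs_gt0.
rewrite lee_fin; apply: phi_mono => k; rewrite mxE.
case: eqP => [//|/eqP zk].
by rewrite -ler_expR lnK ?posrE ?cabs_gt0.
Qed.

(** Logarithmic growth of u is linear growth of phi. The diagonal is enough, since monotonicity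
    bounds phi t by its value at a constant vector. *)
Lemma phi_growth : exists2 C : R, 0 <= C & forall s, 0 <= s -> phi (const_mx s) <= C * (1 + s).
Proof.
have [[_ [C [r uC]]] _] := Lu.
pose N : R := Num.sqrt n%:R.
have N1 : 1 <= N by rewrite -[leLHS]sqrtr1 ler_wsqrtr // ler1n.
have cn (s : R) : cnorm (expv (const_mx s : 'rV[R]_n)) = N * expR s.
  rewrite /cnorm (eq_bigr (fun=> expR s ^+ 2)) => [|k _]; last by rewrite cabs_expv mxE.
  by rewrite sumr_const card_ord -mulr_natl sqrtrM // sqrtr_sqr ger0_norm // expR_ge0.
pose s0 := `|r|.
have far (s : R) : s0 <= s -> phi (const_mx s) <= `|C| * (ln N + s).
  move=> ss; have : r < cnorm (expv (const_mx s : 'rV[R]_n)).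
    rewrite cn; apply: (@le_lt_trans _ _ s); first by apply: le_trans ss; exact: ler_norm.
    apply: (@lt_le_trans _ _ (expR s)); first by apply: lt_le_trans (expR_ge1Dx s); rewrite ltrDr.
    by rewrite ler_peMl // expR_ge0.
  move=> /uC; rewrite u_expvE cn lee_fin lnM ?posrE ?expR_gt0 ?(lt_le_trans ltr01) //.
  rewrite expRK => /le_trans; apply.
  rewrite ler_wpM2r ?ler_norm // addr_ge0 ?ln_ge0 //.
  by apply: le_trans ss; rewrite /s0 normr_ge0.
exists (`|phi (const_mx s0)| + `|C| * (1 + ln N)) => [|s s_ge0].
  by rewrite addr_ge0 // mulr_ge0 // addr_ge0 // ln_ge0.
have lnN : 0 <= ln N by rewrite ln_ge0.
rewrite mulrDl; have [ss|ss] := leP s0 s.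
  apply: (le_trans (far _ ss)).
  apply: (@le_trans _ _ (`|C| * (1 + ln N) * (1 + s))); last first.
    by rewrite lerDr mulr_ge0 // addr_ge0.
  rewrite -mulrA ler_wpM2l //; nra.
apply: (@le_trans _ _ (phi (const_mx s0))).
  by apply: phi_mono => k; rewrite !mxE ltW.
apply: (@le_trans _ _ (`|phi (const_mx s0)| * (1 + s))).
  by apply: le_trans (ler_norm _) _; rewrite ler_peMr // lerDl.
by rewrite lerDl !mulr_ge0 // addr_ge0.
Qed.

End ToricPotential.

(** * Slopes of convex functions *)

Section Slope.
Variables (R : realType) (n : nat).
Implicit Types (t x y : 'rV[R]_n).

Definition convex_fun (f : 'rV[R]_n -> R) := forall x y (l : R), 0 <= l <= 1 ->
  f ((1 - l) *: x + l *: y) <= (1 - l) * f x + l * f y.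

Definition slope (f : 'rV[R]_n -> R) (r : R) t : R := (f (r *: t) - f 0) / r.

Lemma slope_nondecreasing f r s t : convex_fun f -> 0 < r -> r <= s ->
  slope f r t <= slope f s t.
Proof.
move=> f_convex r0 rs; have s0 : 0 < s := lt_le_trans r0 rs.
have l01 : 0 <= r / s <= 1.
  by apply/andP; split; [rewrite divr_ge0 // ltW|rewrite ler_pdivrMr // mul1r].
have := f_convex 0 (s *: t) _ l01.
rewrite scaler0 add0r scalerA divfK ?gt_eqF // => H.
rewrite /slope ler_pdivrMr //.
have -> : (f (s *: t) - f 0) / s * r = r / s * (f (s *: t) - f 0) by ring.
lra.
Qed.

Definition fpos (f : 'rV[R]_n -> R) t : R := Num.max (f t) 0.

Lemma convex_fpos f : convex_fun f -> convex_fun (fpos f).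
Proof.
move=> cf x y l /[dup] l01 /andP[l0 l1]; rewrite /fpos ge_max; apply/andP; split.
  apply: le_trans (cf _ _ _ l01) _; apply: lerD; rewrite ler_wpM2l ?subr_ge0 //.
    by rewrite le_max lexx.
  by rewrite le_max lexx.
by rewrite addr_ge0 // mulr_ge0 ?subr_ge0 // le_max lexx orbT.
Qed.

Definition dotp t t' : R := \sum_k t ord0 k * t' ord0 k.

Lemma dotpZ x (s : R) t : dotp x (s *: t) = s * dotp x t.
Proof. by rewrite /dotp mulr_sumr; apply: eq_bigr => k _; rewrite mxE; ring. Qed.

(** The dual of the sup norm [|t|]: the most that moving a by at most 1 in each coordinate adds to
    <a, t>. *)
Definition l1norm t : R := \sum_k `|t ord0 k|.

Lemma l1norm_ge0 t : 0 <= l1norm t.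
Proof. exact: sumr_ge0. Qed.

Lemma le_l1norm t k : `|t ord0 k| <= l1norm t.
Proof. by rewrite /l1norm (bigD1 k) //= lerDl sumr_ge0. Qed.

Lemma coord_le_norm t k : `|t ord0 k| <= `|t|.
Proof.
rewrite -[leRHS]/(mx_norm t) mx_normrE; apply/bigmax_geP; right => /=.
by exists (ord0, k).
Qed.

Lemma l1norm_le t : l1norm t <= n%:R * `|t|.
Proof.
rewrite /l1norm; apply: (@le_trans _ _ (\sum_(k < n) `|t|)).
  by apply: ler_sum => k _; exact: coord_le_norm.
by rewrite sumr_const card_ord mulr_natl.
Qed.

Lemma dotp_le x t : dotp x t <= l1norm x * `|t|.
Proof.
rewrite /dotp /l1norm mulr_suml; apply: ler_sum => k _.
apply: le_trans (ler_norm _) _; rewrite normrM ler_wpM2l //.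
exact: coord_le_norm.
Qed.

Lemma continuous_dotp x : continuous (dotp x).
Proof.
move=> t; apply: (@continuous_sum _ _ _ _ (fun k (t : 'rV[R]_n) => x ord0 k * t ord0 k)) => k.
exact: (continuousM (@cst_continuous _ _ (x ord0 k) t) (@coord_continuous R 1 n ord0 k t)).
Qed.

Lemma compact_sphere : compact [set t : 'rV[R]_n | `|t| = 1].
Proof.
apply: bounded_closed_compact.
  by exists 1; split; [exact: num_real|move=> M M1 t /= ->; exact: ltW].
rewrite (_ : mkset _ = (fun t : 'rV[R]_n => `|t|) @^-1` [set 1]) //.
by apply: closed_comp; [move=> t _; exact: norm_continuous|exact: closed_eq].
Qed.

End Slope.

(** * The recession function and the interior of Gamma *)

Section Recession.
Variables (R : realType) (n : nat) (f : 'rV[R]_n -> R).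
Implicit Types (t x y a : 'rV[R]_n).

Hypothesis f_convex : convex_fun f.
Hypothesis f_usc : forall t (c : R), f t < c -> \forall t' \near t, f t' < c.
Hypothesis f_mono : forall x y, (forall k, x ord0 k <= y ord0 k) -> f x <= f y.
Hypothesis f_growth : exists2 C : R, 0 <= C & forall s, 0 <= s -> f (const_mx s) <= C * (1 + s).

(** Slopes are nondecreasing in r, so this supremum is their limit at infinity ([cvg_recess]). *)
Definition recess t : R := sup [set slope f r t | r in [set r | 0 < r]].

Lemma slope_has_ubound t : has_ubound [set slope f r t | r in [set r : R | 0 < r]].
Proof.
have [C C0 fC] := f_growth.
pose m := l1norm t; have m0 : 0 <= m by exact: l1norm_ge0.
have tm k : t ord0 k <= m by exact: le_trans (ler_norm _) (le_l1norm t k).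
pose B := C * (1 + m) + `|f 0|.
exists B => _ [r /= r0 <-].
(* Raising r to at least 1 only increases the slope, and allows constants to be absorbed into
   multiples of r. *)
apply: (@le_trans _ _ (slope f (Num.max r 1) t)).
  by apply: slope_nondecreasing => //; rewrite le_max lexx.
have s1 : 1 <= Num.max r 1 by rewrite le_max lexx orbT.
move: (Num.max r 1) s1 => s s1; have s0 : 0 < s by lra.
rewrite /slope ler_pdivrMr //.
have h : f (s *: t) <= C * (1 + s * m).
  apply: (@le_trans _ _ (f (const_mx (s * m)))); last by apply: fC; rewrite mulr_ge0 // ltW.
  by apply: f_mono => k; rewrite !mxE ler_wpM2l // ltW.
have h2 : - f 0 <= `|f 0| * s.
  by apply: (@le_trans _ _ `|f 0|); [rewrite -normrN ler_norm|rewrite ler_peMr].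
have h3 : C * (1 + s * m) <= C * (1 + m) * s.
  by rewrite -mulrA ler_wpM2l //; lra.
by rewrite /B mulrDl; lra.
Qed.

Lemma slope_le_recess r t : 0 < r -> slope f r t <= recess t.
Proof. by move=> r0; apply: (ub_le_sup (slope_has_ubound t)); exists r. Qed.

Lemma recess_le t (c : R) : (forall r, 0 < r -> slope f r t <= c) -> recess t <= c.
Proof.
move=> H; apply: ge_sup; first by exists (slope f 1 t); exists 1 => /=.
by move=> _ [r r0 <-]; exact: H.
Qed.

Lemma recess_slope_gt t (c : R) : c < recess t -> exists2 r, 0 < r & c < slope f r t.
Proof.
move=> cr; apply: contrapT => H; move: cr; apply/negP; rewrite -leNgt.
apply: recess_le => r r0; rewrite leNgt; apply/negP => cs; apply: H; exists r => //.
Qed.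

Lemma f_le_recess t : f t <= recess t + f 0.
Proof.
by have := slope_le_recess t ltr01; rewrite /slope scale1r divr1 lerBlDr.
Qed.

Lemma recess_subadd x y : recess (x + y) <= recess x + recess y.
Proof.
apply: recess_le => r r0.
have r2 : 0 < 2 * r by rewrite mulr_gt0.
apply: le_trans (lerD (slope_le_recess x r2) (slope_le_recess y r2)).
have h : 0 <= (2^-1 : R) <= 1 by rewrite invr_ge0 ler0n invf_le1 // ler1n.
have := f_convex ((2 * r) *: x) ((2 * r) *: y) h.
have -> : (1 - 2^-1) *: ((2 * r) *: x) + 2^-1 *: ((2 * r) *: y) = r *: (x + y).
  by apply/rowP => k; rewrite !mxE; field.
rewrite /slope ler_pdivrMr // => H.
apply: (le_trans (lerB H (lexx (f 0)))).
rewrite le_eqVlt; apply/orP; left; apply/eqP; field.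
by rewrite gt_eqF.
Qed.

Lemma recessZ_le (s : R) t : 0 < s -> recess (s *: t) <= s * recess t.
Proof.
move=> s0; apply: recess_le => r r0.
have -> : slope f r (s *: t) = s * slope f (r * s) t.
  by rewrite /slope scalerA; field; rewrite !gt_eqF.
by rewrite ler_pM2l // slope_le_recess // mulr_gt0.
Qed.

Lemma recess_mono x y : (forall k, x ord0 k <= y ord0 k) -> recess x <= recess y.
Proof.
move=> xy; apply: recess_le => r r0.
apply: le_trans (slope_le_recess y r0).
rewrite /slope ler_pM2r ?invr_gt0 // lerD2r; apply: f_mono => k.
by rewrite !mxE ler_pM2l.
Qed.

Lemma cvg_recess t : r^-1 * f (r *: t) @[r --> +oo%R] --> recess t.
Proof.
have H1 : slope f r t @[r --> +oo%R] --> recess t.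
  apply/cvgrPdist_lt => e e0.
  have [r r0 er] : exists2 r, 0 < r & recess t - e < slope f r t.
    by apply: recess_slope_gt; rewrite ltrBlDr ltrDl.
  near=> s.
  have rs : r <= s by near: s; apply: nbhs_pinfty_ge; rewrite num_real.
  have := slope_nondecreasing t f_convex r0 rs.
  have := slope_le_recess t (lt_le_trans r0 rs).
  by move=> h1 h2; rewrite ger0_norm; lra.
have H2 : r^-1 * f 0 @[r --> +oo%R] --> (0 : R).
  rewrite -[X in _ --> X](mul0r (f 0)); apply: cvgM; last exact: cvg_cst.
  apply: (iffRL (@gtr0_cvgV0 R R +oo%R _ (fun r => r) _)); last exact: cvg_id.
  by apply: nbhs_pinfty_gt; rewrite num_real.
have -> : (fun r : R => r^-1 * f (r *: t)) = (fun r => slope f r t + r^-1 * f 0).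
  by apply/funext => r; rewrite /slope; ring.
by rewrite -[recess t]addr0; exact: cvgD H1 H2.
Unshelve. all: by end_near. Qed.

(** t is the midpoint of t' and its reflection 2 t - t'. Upper semicontinuity bounds f at the
    reflection, so convexity forces f t' to be large. *)
Lemma f_lsc t (c : R) : c < f t -> \forall t' \near t, c < f t'.
Proof.
move=> ct; pose e := f t - c; have e0 : 0 < e by rewrite subr_gt0.
have : \forall t' \near t, f (t + t - t') < f t + e.
  have cc : {for t, continuous (fun t' : 'rV[R]_n => t + t - t')}.
    exact: (cvgB (@cst_continuous _ _ (t + t) t) cvg_id).
  have : f (t + t - t) < f t + e by rewrite addrK ltrDl.
  by move=> /f_usc; exact: cc.
apply: filterS => t' ft'.
have h : 0 <= (2^-1 : R) <= 1 by rewrite invr_ge0 ler0n invf_le1 // ler1n.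
have := f_convex t' (t + t - t') h.
have -> : (1 - 2^-1) *: t' + 2^-1 *: (t + t - t') = t.
  by apply/rowP => k; rewrite !mxE; field.
by move: ft'; rewrite /e; lra.
Qed.

Lemma fpos_lsc t (c : R) : c < fpos f t -> \forall t' \near t, c < fpos f t'.
Proof.
rewrite /fpos lt_max => /orP[/f_lsc|c0].
  by apply: filterS => t' ct; rewrite lt_max ct.
by near=> t'; rewrite lt_max c0 orbT.
Unshelve. all: by end_near. Qed.

Definition Gam : set 'rV[R]_n := [set a | forall t, dotp a t <= Num.max (recess t) 0].

Definition strict_below a := forall t, t != 0 -> dotp a t < Num.max (recess t) 0.

(** Being interior to [Gam], [strict_below] and [coercive_gap] are equivalent, through the cycle of
    implications below. Divergence is derived from the failure of [strict_below], integrability from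
    [coercive_gap]. *)
Definition coercive_gap a := exists e C : R,
  [/\ 0 < e, 0 <= C & forall t, dotp a t + e * l1norm t <= fpos f t + C].

Lemma fpos0_ge0 t : 0 <= fpos f t.
Proof. by rewrite /fpos le_max lexx orbT. Qed.

(** A strict inequality at infinity already shows at a finite radius. The margin 1 / r decreases
    with r while the slope increases, so the inequality persists at larger radii, as the compactness
    argument needs. *)
Lemma strict_below_slope a t : dotp a t < Num.max (recess t) 0 ->
  exists2 r : R, 0 < r & dotp a t + r^-1 < (fpos f (r *: t) - fpos f 0) / r.
Proof.
have big (e D : R) : 0 < e -> \forall r \near +oo%R, D / r < e.
  move=> e0; near=> r.
  have r0 : 0 < r by near: r; apply: nbhs_pinfty_gt; rewrite num_real.
  rewrite ltr_pdivrMr // mulrC -ltr_pdivrMr //.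
  by near: r; apply: nbhs_pinfty_gt; rewrite num_real.
pose b := fpos f 0.
rewrite lt_max => /orP[lt1|lt1].
- have [r r0 rt] := recess_slope_gt lt1.
  have e0 : 0 < slope f r t - dotp a t by rewrite subr_gt0.
  have /filter_ex [s [rs sb]] : \forall s \near +oo%R, r <= s /\
      (1 + (b - f 0)) / s < slope f r t - dotp a t.
    apply: filterI; last exact: big.
    by apply: nbhs_pinfty_ge; rewrite num_real.
  have s0 : 0 < s by exact: lt_le_trans rs.
  exists s => //.
  have := slope_nondecreasing t f_convex r0 rs.
  have : slope f s t - (b - f 0) / s <= (fpos f (s *: t) - fpos f 0) / s.
    rewrite /slope -mulrBl ler_pM2r ?invr_gt0 // /b.
    suff : f (s *: t) <= fpos f (s *: t) by lra.
    by rewrite /fpos le_max lexx.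
  by move: sb; rewrite mulrDl mul1r; lra.
- have e0 : 0 < - dotp a t by rewrite oppr_gt0.
  have /filter_ex [s [s0 sb]] : \forall s \near +oo%R, 0 < s /\ (1 + b) / s < - dotp a t.
    apply: filterI; last exact: big.
    by apply: nbhs_pinfty_gt; rewrite num_real.
  exists s => //.
  have : - b / s <= (fpos f (s *: t) - fpos f 0) / s.
    by rewrite ler_pM2r ?invr_gt0 // /b lerBrDr addNr fpos0_ge0.
  by move: sb; rewrite mulrDl mul1r mulNr; lra.
Unshelve. all: by end_near. Qed.

Lemma strict_below_coercive a : strict_below a -> coercive_gap a.
Proof.
move=> sb.
have cvp : convex_fun (fpos f) by exact: convex_fpos.
have /filter_ex [r0 [r00 Hr]] : \forall r \near +oo%R, 0 < r /\
    [set t : 'rV[R]_n | `|t| = 1] `<=`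
    [set t | dotp a t + r^-1 < slope (fpos f) r t].
  apply: filterI; first by apply: nbhs_pinfty_gt; rewrite num_real.
  have /compact_near_coveringP cS := @compact_sphere R n.
  apply: (cS R (pinfty_nbhs R) (fun r t => dotp a t + r^-1 < slope (fpos f) r t)) => t /= t1.
  have t0 : t != 0 by rewrite -normr_eq0 t1 oner_eq0.
  have [r r0 rt] := strict_below_slope (sb _ t0).
  (* v separates the two sides, so continuity of [dotp a] and lower semicontinuity of [fpos f] can
     be used independently near t. *)
  pose v := (dotp a t + r^-1 + (fpos f (r *: t) - fpos f 0) / r) / 2.
  have v1 : dotp a t < v - r^-1 by rewrite /v; lra.
  have v2 : v * r + fpos f 0 < fpos f (r *: t).
    have : v < (fpos f (r *: t) - fpos f 0) / r by rewrite /v; lra.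
    by rewrite ltr_pdivlMr //; lra.
  have N1 : \forall t' \near t, dotp a t' < v - r^-1.
    by move: (@continuous_dotp _ _ a t) => /cvgr_lt; apply.
  have N2 : \forall t' \near t, v * r + fpos f 0 < fpos f (r *: t').
    have cs : {for t, continuous (fun t' : 'rV[R]_n => r *: t')} by exact: (@scaler_continuous _ _ r t).
    exact: (cs _ (fpos_lsc v2)).
  near=> t' s => /=.
  have rs : r <= s by near: s; apply: nbhs_pinfty_ge; rewrite num_real.
  apply: lt_le_trans (slope_nondecreasing t' cvp r0 rs).
  apply: (@le_lt_trans _ _ (dotp a t' + r^-1)).
    by rewrite lerD2l lef_pV2 ?posrE // (lt_le_trans r0).
  have h1 : dotp a t' < v - r^-1 by near: t'; exact: N1.
  have h2 : v * r + fpos f 0 < fpos f (r *: t') by near: t'; exact: N2.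
  by rewrite /slope ltr_pdivlMr //; move: h1 h2; nra.
(* [l1norm t] is at most n times the sup norm; n + 1 keeps N positive when n = 0. *)
pose N : R := n.+1%:R.
have N0 : 0 < N by rewrite ltr0n.
pose e := (r0 * N)^-1; have e0 : 0 < e by rewrite invr_gt0 mulr_gt0.
have el t : e * l1norm t <= `|t| / r0.
  rewrite /e mulrC ler_pdivrMr ?mulr_gt0 //.
  have -> : `|t| / r0 * (r0 * N) = N * `|t| by field; rewrite gt_eqF.
  apply: le_trans (l1norm_le t) _.
  by rewrite ler_wpM2r // ler_nat.
(* This constant covers |t| < r0; for larger t the slope inequality at t / |t| with radius |t| >= r0
   applies. *)
exists e, (l1norm a * r0 + 1); split => //.
  by rewrite addr_ge0 // mulr_ge0 ?l1norm_ge0 // ltW.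
move=> t; have [tr|tr] := ltP `|t| r0.
  apply: (@le_trans _ _ (l1norm a * r0 + 1)); last by rewrite lerDr fpos0_ge0.
  apply: lerD.
    apply: le_trans (dotp_le a t) _.
    by rewrite ler_wpM2l ?l1norm_ge0 // ltW.
  by apply: le_trans (el t) _; rewrite ler_pdivrMr // mul1r ltW.
have rho0 : 0 < `|t| by exact: lt_le_trans tr.
have n1 : `|(`|t|^-1 *: t)| = 1.
  by rewrite normrZ normfV normr_id mulVf // gt_eqF.
have := Hr _ n1 => /= H.
have := lt_le_trans H (slope_nondecreasing _ cvp r00 tr).
rewrite /slope scalerA divff ?gt_eqF // scale1r ltr_pdivlMr //.
have -> : (dotp a (`|t|^-1 *: t) + r0^-1) * `|t| = dotp a t + `|t| / r0.
  by rewrite dotpZ mulrDl mulrAC mulVf ?gt_eqF // mul1r mulrC.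
have := el t; have := fpos0_ge0 0.
have : 0 <= l1norm a * r0 by rewrite mulr_ge0 ?l1norm_ge0 // ltW.
lra.
Unshelve. all: by end_near. Qed.

Lemma coercive_interior a : coercive_gap a -> interior Gam a.
Proof.
move=> [e [C [e0 C0 gap]]]; apply/nbhs_ballP; exists e => //= a' [_ aa'].
have dle t : dotp a' t <= dotp a t + e * l1norm t.
  rewrite /dotp /l1norm mulr_sumr -big_split /=; apply: ler_sum => k _.
  have h : `|a' ord0 k - a ord0 k| <= e by rewrite distrC ltW //; exact: aa'.
  have : (a' ord0 k - a ord0 k) * t ord0 k <= e * `|t ord0 k|.
    by apply: le_trans (ler_norm _) _; rewrite normrM ler_wpM2r.
  lra.
move=> t; apply/ler_addgt0Pr => d d0.
(* At r t the constants |f 0| and C weigh only 1 / r, which this choice makes smaller than d. *)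
pose r := (`|f 0| + C + 1) / d.
have r0 : 0 < r by rewrite divr_gt0 // ltr_wpDl // addr_ge0.
have rd : r * d = `|f 0| + C + 1 by rewrite /r divfK // gt_eqF.
have H := le_trans (dle (r *: t)) (gap (r *: t)).
rewrite dotpZ in H.
have f1 := f_le_recess (r *: t); have f2 := recessZ_le t r0.
rewrite -(ler_pM2l r0) mulrDr rd.
set m := Num.max _ _; have m1 : recess t <= m by rewrite le_max lexx.
have m0 : 0 <= m by rewrite le_max lexx orbT.
have : fpos f (r *: t) <= r * m + `|f 0|.
  rewrite /fpos ge_max; apply/andP; split; last by rewrite addr_ge0 // mulr_ge0 // ltW.
  have : r * recess t <= r * m by rewrite ler_pM2l.
  have := ler_norm (f 0); lra.
lra.
Qed.

Lemma interior_strict_below a : interior Gam a -> strict_below a.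
Proof.
move=> /nbhs_ballP [e /= e0 aG] t t0.
(* Moving a along the signs of t stays in the ball and raises <a, t> by (e / 2) [l1norm t]. *)
pose a' := \row_k (a ord0 k + e / 2 * Num.sg (t ord0 k)) : 'rV[R]_n.
have aa' : ball a e a'.
  split => // i j; rewrite ord1 /ball /= mxE opprD addNKr normrN normrM.
  apply: (@le_lt_trans _ _ (e / 2)); last by rewrite ltr_pdivrMr // ltr_pMr // ltr1n.
  have e2 : 0 < e / 2 by rewrite divr_gt0.
  rewrite (gtr0_norm e2) ler_piMr //; first exact: ltW.
  by rewrite normr_sg; case: eqP => //= _; rewrite ler01.
apply: lt_le_trans (aG _ aa' t).
have -> : dotp a' t = dotp a t + e / 2 * l1norm t.
  rewrite /dotp /l1norm mulr_sumr -big_split /=; apply: eq_bigr => k _.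
  by rewrite mxE normrEsg; ring.
rewrite ltrDl mulr_gt0 ?divr_gt0 //.
have [k tk] : exists k, t ord0 k != 0.
  apply: contrapT => H; move/eqP: t0; apply; apply/rowP => k; rewrite mxE.
  by apply/eqP; apply: contrapT => tk; apply: H; exists k; apply/negP.
by apply: lt_le_trans (le_l1norm t k); rewrite normr_gt0.
Qed.

End Recession.

(** * The logarithmic indicator as a recession function *)

Section Indicator.
Variables (R : realType) (n : nat) (u : Cn R n -> \bar R).
Implicit Types (t x y : 'rV[R]_n) (z : Cn R n).

Lemma lnv_expv t : lnv (expv t) = t.
Proof. by apply/rowP => k; rewrite mxE cabs_expv expRK. Qed.

Lemma expv_neq0 t k : expv t k != 0.
Proof. by rewrite -cabs_gt0 cabs_expv expR_gt0. Qed.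

Hypotheses (n0 : (0 < n)%N) (Lu : LPSHstar u) (toru : toric u).
Local Notation phi := (phi u).

Lemma cvg_recess_phi t : r^-1 * phi (r *: t) @[r --> +oo%R] --> recess phi t.
Proof.
apply: cvg_recess.
- exact: phi_convex.
- exact: phi_mono.
- exact: phi_growth.
Qed.

Lemma sup_polydisc (r : R) z : (forall k, z k != 0) ->
  ereal_sup (u @` [set zeta : Cn R n | forall k, (cabs (zeta k) <= cabs (z k) `^ r)%R])
  = (phi (r *: lnv z))%:E.
Proof.
move=> z0.
have E k : cabs (z k) `^ r = expR ((r *: lnv z) ord0 k).
  by rewrite /powR cabs_eq0 (negbTE (z0 k)) !mxE.
apply/eqP; rewrite eq_le; apply/andP; split.
  apply: ge_ereal_sup => _ [zeta /= zle <-].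
  by apply: u_le_phi => // k; rewrite -E.
rewrite -u_expvE //; apply: ereal_sup_ubound; exists (expv (r *: lnv z)) => //= k.
by rewrite E cabs_expv.
Qed.

Lemma Psi_torus z : (forall k, z k != 0) -> Psi u z = (recess phi (lnv z))%:E.
Proof.
move=> z0; rewrite /Psi.
have -> : in_torus z by apply/forallP.
rewrite /Psi0; apply: cvg_lim => //.
under eq_fun do rewrite sup_polydisc // -EFinM.
by apply: cvg_EFin; [near=> r|exact: cvg_recess_phi].
Unshelve. all: by end_near. Qed.

Lemma Gamma_infE : Gamma_inf u = Gam phi.
Proof.
have E t : psi u t = (recess phi t)%:E.
  rewrite -[t in RHS]lnv_expv /psi; apply: Psi_torus => k; exact: expv_neq0.
by apply/seteqP; split=> a Ha t; have := Ha t; rewrite E -EFin_max lee_fin.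
Qed.

End Indicator.

(** * From exponential decay in log |z_k| to the integrable weight *)

Section UpperBound.
Variable R : realType.

Lemma expR_sqr_le (x : R) : 1 + x ^+ 2 <= 4 * expR `|x|.
Proof.
have -> : expR `|x| = expR (`|x| / 2) ^+ 2 by rewrite -expRM_natl; congr expR; field.
have h := expR_ge1Dx (`|x| / 2).
have a0 : 0 <= `|x| := normr_ge0 x.
have : (1 + `|x| / 2) ^+ 2 <= expR (`|x| / 2) ^+ 2 by rewrite lerXn2r ?nnegrE ?expR_ge0 //; lra.
have : x ^+ 2 = `|x| ^+ 2 by rewrite -normrX ger0_norm // sqr_ge0.
move=> ->; lra.
Qed.

(** The coercive gap yields exponential decay in |log |x||; the weaker rational decay of [logw] is
    the one with an explicit antiderivative. *)
Lemma logw_ge (e x : R) : x != 0 -> expR (- ln `|x| - `|e * ln `|x| |) <= 4 * logw e x.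
Proof.
move=> x0; rewrite /logw expRD mulrCA ler_pM2l ?expR_gt0 // expRN.
rewrite -ler_pdivrMl // -invfM lef_pV2 ?posrE ?mulr_gt0 ?expR_gt0 //.
  exact: expR_sqr_le.
by rewrite ltr_wpDr // sqr_ge0.
Qed.

(* With s = log |z_k| this replaces the polar coordinate integral by a product of integrals
   over the real and imaginary parts. *)
Lemma polar_bound (e a b : R) : 0 < e -> e <= 1 -> a != 0 -> b != 0 ->
  expR (- (2 * ln (cabs (Complex a b))) - 2 * e * `|ln (cabs (Complex a b))|) <=
  16 * expR 2 * (logw e a * logw e b).
Proof.
move=> e0 e1 a0 b0.
wlog ab : a b a0 b0 / `|b| <= `|a|.
  move=> H; have [|/ltW ab] := leP `|b| `|a|; first exact: H.
  have -> : cabs (Complex a b) = cabs (Complex b a) by rewrite /cabs /= addrC.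
  by rewrite [logw e a * _]mulrC; apply: H.
set s := ln (cabs _).
have a1 : 0 < `|a| by rewrite normr_gt0.
have b1 : 0 < `|b| by rewrite normr_gt0.
have r1 : `|a| <= cabs (Complex a b).
  by rewrite -sqrtr_sqr /cabs /= ler_wsqrtr // lerDl sqr_ge0.
have r2 : cabs (Complex a b) <= 2 * `|a|.
  have -> : 2 * `|a| = Num.sqrt ((2 * `|a|) ^+ 2) by rewrite sqrtr_sqr normrM normr_id (@gtr0_norm _ 2).
  rewrite /cabs /= ler_wsqrtr //.
  have : b ^+ 2 <= a ^+ 2.
    by rewrite -[b ^+ 2]ger0_norm ?sqr_ge0 // -[a ^+ 2]ger0_norm ?sqr_ge0 // !normrX lerXn2r ?nnegrE.
  have -> : (2 * `|a|) ^+ 2 = 4 * a ^+ 2.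
    by rewrite exprMn -normrX ger0_norm ?sqr_ge0 //; ring.
  have := sqr_ge0 a; lra.
have r0 : 0 < cabs (Complex a b) by apply: lt_le_trans r1.
pose al := ln `|a|; pose be := ln `|b|.
have h1 : al <= s by rewrite ler_ln ?posrE.
have h2 : s <= al + 1.
  apply: (@le_trans _ _ (ln (2 * `|a|))); first by rewrite ler_ln ?posrE // mulr_gt0.
  rewrite lnM ?posrE // addrC lerD2l.
  have := @le_ln1Dx R 1 ltac:(lra); have -> : 1 + 1 = 2 :> R by ring. lra.
have h3 : be <= al by rewrite ler_ln ?posrE.
have -> : 16 * expR 2 * (logw e a * logw e b) =
   expR 2 * ((4 * logw e a) * (4 * logw e b)) by ring.
apply: (@le_trans _ _ (expR 2 * (expR (- al - `|e * al|) * expR (- be - `|e * be|)))).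
  rewrite -!expRD ler_expR !normrM (gtr0_norm e0).
  have n1 : `|al| <= `|s| + 1.
    by rewrite ler_norml; have := ler_norm s; have := ler_norm (- s); rewrite normrN => *; apply/andP; split; lra.
  have n2 : `|be| <= `|al| + (al - be).
    by rewrite ler_norml; have := ler_norm al; have := ler_norm (- al); rewrite normrN => *; apply/andP; split; lra.
  have n3 : e * `|al| <= e * (`|s| + 1) by rewrite ler_wpM2l // ltW.
  have n4 : e * `|be| <= e * (`|al| + (al - be)) by rewrite ler_wpM2l // ltW.
  (* As e <= 1, the loss e (al - be) is paid by the smaller coordinate, which contributes be instead
     of al. The remaining 2 e is at most the 2 of [expR 2]. *)
  have n5 : e * (al - be) <= al - be by rewrite ler_piMl // subr_ge0.
  lra.
rewrite ler_pM2l ?expR_gt0 //.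
by apply: ler_pM; rewrite ?expR_ge0 //; exact: logw_ge.
Qed.

Lemma prod_pairs (T : comRingType) m (F : nat -> T) :
  \prod_(j < 2 * m) F j = \prod_(k < m) (F (2 * k)%N * F (2 * k).+1).
Proof.
elim: m => [|m IH]; first by rewrite muln0 !big_ord0.
by rewrite mulnS !addSn add0n !big_ord_recr /= IH mulrA.
Qed.

Lemma compact_matrix_box m p (rho : R) :
  compact [set A : 'M[R]_(m, p) | forall i j, `|A i j| <= rho].
Proof.
have cvec : continuous (@vec_mx R m p).
  move=> v B /nbhs_ballP [e /= e0 eB]; apply/nbhs_ballP; exists e => // v' [_ vv'].
  by apply: eB; split=> // i j; rewrite !mxE; exact: vv'.
rewrite (_ : mkset _ = @vec_mx R m p @` [set v : 'rV[R]_(m * p) | forall i, (`[- rho, rho]%classic : set R) (v ord0 i)]).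
  apply: continuous_compact; first exact: continuous_subspaceT.
  by apply: (@rV_compact _ _ (fun=> `[- rho, rho]%classic)) => _; exact: segment_compact.
apply/seteqP; split=> [A HA|_ [v Hv <-] i j] /=.
  exists (mxvec A); last exact: mxvecK.
  move=> i; case/mxvec_indexP: i => i j.
  by rewrite mxvecE /= in_itv /= -ler_norml; exact: HA.
by have := Hv (mxvec_index i j); rewrite mxE /= in_itv /= -ler_norml.
Qed.

End UpperBound.

(** * Integrability when J + 1 is interior *)

Section Sufficiency.
Variables (R : realType) (n : nat).
Implicit Types (t x y : 'rV[R]_n) (z : Cn R n).

Lemma cabs_monom (J : 'I_n -> nat) z : cabs (monom J z) = \prod_k cabs (z k) ^+ J k.
Proof. by rewrite cabs_prod; apply: eq_bigr => k _; rewrite cabsX. Qed.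

(** The sum of the t_k is split off so that J + 1 appears; once squared, the factor e^{- sum t_k}
    compensates the volume factor. *)
Lemma cabs_monom_expR (J : 'I_n -> nat) z : (forall k, z k != 0) ->
  cabs (monom J z) = expR (dotp (shift1 R J) (lnv z) - \sum_k lnv z ord0 k).
Proof.
move=> z0; rewrite cabs_monom /dotp -sumrB (big_morph _ (@expRD R) (@expR0 R)).
apply: eq_bigr => k _; rewrite !mxE.
have -> : (J k).+1%:R * ln (cabs (z k)) - ln (cabs (z k)) = (J k)%:R * ln (cabs (z k)).
  by rewrite -natr1; ring.
by rewrite expRM_natl lnK // posrE cabs_gt0.
Qed.

(** The inverse of 1 + sum 1 / e_i lies below every e_i and below 1, even for m = 0; [polar_bound]
    requires e <= 1. *)
Lemma coercive_gap_uniform (f : 'rV[R]_n -> R) m (a : 'I_m -> 'rV[R]_n) :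
  (forall i, coercive_gap f (a i)) ->
  exists e C : R, [/\ 0 < e, e <= 1, 0 <= C &
    forall i t, dotp (a i) t + e * l1norm t <= fpos f t + C].
Proof.
move=> gap.
have /choice [p pP] : forall i, exists p : R * R, [/\ 0 < p.1, 0 <= p.2 &
    forall t, dotp (a i) t + p.1 * l1norm t <= fpos f t + p.2].
  by move=> i; have [e [C H]] := gap i; exists (e, C).
pose s := \sum_i (p i).1^-1.
have s0 : 0 <= s by apply: sumr_ge0 => i _; rewrite invr_ge0; case: (pP i) => /ltW.
have s1 : 0 < 1 + s by rewrite ltr_pwDl.
exists (1 + s)^-1, (\sum_i (p i).2); split.
- by rewrite invr_gt0.
- by rewrite invf_le1 // lerDl.
- by apply: sumr_ge0 => i _; case: (pP i).
move=> i t; have [pi0 _ H] := pP i.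
have es : (1 + s)^-1 <= (p i).1.
  rewrite -[leRHS]invrK lef_pV2 ?posrE ?invr_gt0 //.
  rewrite ler_wpDl // /s (bigD1 i) //= lerDl sumr_ge0 // => j _.
  by rewrite invr_ge0; case: (pP j) => /ltW.
have Cs : (p i).2 <= \sum_i (p i).2.
  by rewrite (bigD1 i) //= lerDl sumr_ge0 // => j _; case: (pP j).
have := ler_wpM2r (l1norm_ge0 t) es; have := H t; lra.
Qed.

Variable u : Cn R n -> \bar R.
Hypotheses (n0 : (0 < n)%N) (Lu : LPSHstar u) (toru : toric u).
Local Notation phi := (phi u).

Local Open Scope ereal_scope.

Lemma prod_logwe_infty d (e : R) (v : nat -> R) (j : 'I_d) : v j = 0%R ->
  \prod_(i < d) logwe e (v i) = +oo.
Proof.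
move=> vj; rewrite (bigD1 j) //= {1}/logwe vj eqxx gt0_mulye //.
elim/big_ind : _ => // [x y|i _]; first exact: mule_gt0.
by rewrite /logwe; case: ifP => // _; rewrite lte_fin logw_gt0.
Qed.

Lemma prod_logwe_fin d (e : R) (v : nat -> R) : (forall j : 'I_d, v j != 0%R) ->
  \prod_(i < d) logwe e (v i) = (\prod_(i < d) logw e (v i))%:E.
Proof.
move=> v0; elim/big_ind2 : _ => // [x1 x2 y1 y2 -> ->|i _]; first by rewrite EFinM.
by rewrite /logwe (negbTE (v0 i)).
Qed.

Lemma iter_int_logwe_lty d (e D : R) : (0 < e)%R -> (0 <= D)%R ->
  iter_int d (fun v => D%:E * \prod_(j < d) logwe e (v j)) < +oo.
Proof.
move=> e0 D0.
have -> : (fun v : nat -> R => D%:E * \prod_(j < d) logwe e (v j)) =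
    (fun v => \sum_(i < 1) D%:E * \prod_(j < d) logwe e (v j)).
  by apply/funext => v; rewrite big_ord1.
rewrite (@iter_int_sum_prod R d 1 (fun=> D%:E) (fun _ _ => logwe e)); last 3 first.
- by move=> i; rewrite lee_fin.
- by move=> *; exact: logwe_ge0.
- by move=> *; exact: measurable_logwe.
rewrite big_ord1.
have /fineK <- : \int[@lebesgue_measure R]_x logwe e x \is a fin_num.
  rewrite ge0_fin_numE ?integral_logwe_lty //.
  by apply: integral_ge0 => x _; exact: logwe_ge0.
suff [r ->] : exists r : R, \prod_(j < d) (fine (\int[@lebesgue_measure R]_x logwe e x))%:E = r%:E.
  by rewrite -EFinM ltry.
elim/big_ind : _ => [|x y [r ->] [s ->]|i _]; first by exists 1%R.
  by exists (r * s)%R.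
by eexists.
Qed.

Lemma L2inf_of_gap (w : Cn R n -> \bar R) (c0 : R) m (J : 'I_m -> 'I_n -> nat)
    (c : 'I_m -> R[i]) (P : Cn R n -> R[i]) :
  (forall z, (forall k, z k != 0%R) -> (phi (lnv z) - c0)%:E <= w z) ->
  (forall i, coercive_gap phi (shift1 R (J i))) ->
  (forall z, P z = \sum_(i < m) c i * monom (J i) z)%R ->
  L2inf (fun z => (cabs (P z))%:E * expeR (- w z)).
Proof.
move=> wlow gap PE.
have [e [C [e0 e1 C0 gapu]]] := coercive_gap_uniform gap.
have [T uT] := u_pos_far Lu.
pose rho := expR T.
pose K : set (Cn R n) := [set z | forall k,
  (`|complex.Re (z k)| <= rho /\ `|complex.Im (z k)| <= rho)%R].
pose S : R := (\sum_i cabs (c i))%R.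
have S0 : (0 <= S)%R by apply: sumr_ge0 => i _; exact: cabs_ge0.
pose B : R := (S * expR (C + c0))%R.
have B0 : (0 <= B)%R by rewrite mulr_ge0 // expR_ge0.
(* The added 1 keeps D positive when B = 0, so that the majorant is infinite wherever a real
   coordinate vanishes. *)
pose D : R := (B ^+ 2 * (16 * expR 2) ^+ n + 1)%R.
have D0 : (0 < D)%R.
  by rewrite ltr_wpDl // mulr_ge0 ?sqr_ge0 // exprn_ge0 // mulr_ge0 // expR_ge0.
exists K; split.
  rewrite /cn_compact (_ : _ @^-1` _ = [set A : 'M[R]_(n, 2) | forall i j, (`|A i j| <= rho)%R]).
    exact: compact_matrix_box.
  apply/seteqP; split=> A /= HA.
    move=> i j; have [h1 h2] := HA i; case: j => -[|[|//]] /= jlt.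
      by rewrite (_ : Ordinal jlt = ord0) //; apply/val_inj.
    by rewrite (_ : Ordinal jlt = ord_max) //; apply/val_inj.
  by move=> k; split; exact: HA.
apply: le_lt_trans (iter_int_logwe_lty (2 * n) e0 (ltW D0)).
apply: le_iter_int => v.
set z : Cn R n := fun k => _.
have [[j vj]|nv] := pselect (exists j : 'I_(2 * n), v j = 0%R).
  by rewrite (prod_logwe_infty e vj) gt0_muley ?leey // lte_fin.
have v0 (j : 'I_(2 * n)) : v j != 0%R.
  by apply/eqP => vj; apply: nv; exists j.
have v1 (k : 'I_n) : v (2 * k)%N != 0%R /\ v (2 * k).+1 != 0%R.
  have l2 : ((2 * k).+1 < 2 * n)%N.
    by have := ltn_ord k; rewrite -(leq_pmul2l (isT : 0 < 2)%N) mulnS.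
  split; first exact: (v0 (Ordinal (ltnW l2))).
  exact: (v0 (Ordinal l2)).
rewrite prod_logwe_fin // -EFinM.
case: asboolP => [_|nK].
  rewrite lee_fin mulr_ge0 ?(ltW D0) //; apply: prodr_ge0 => j _; exact/ltW/logw_gt0.
have z0 k : z k != 0%R.
  by rewrite /z eq_complex /= negb_and (v1 k).1.
(* Off K some |z_k| exceeds e^T, so phi is positive and equals its positive part; it then cancels
   against the weight e^{-w}. *)
have phi0 : (0 < phi (lnv z))%R.
  rewrite -lte_fin -u_expvE //.
  have [k zk] : exists k, (rho < cabs (z k))%R.
    apply: contrapT => H; apply: nK => k.
    have zk : (cabs (z k) <= rho)%R by rewrite leNgt; apply/negP => h; apply: H; exists k.
    split; apply: le_trans zk; rewrite /cabs -sqrtr_sqr ler_wsqrtr //.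
      by rewrite lerDl sqr_ge0.
    by rewrite lerDr sqr_ge0.
  by apply: (uT _ k); rewrite mxE -ltr_expR lnK // posrE cabs_gt0.
set t := lnv z in phi0 *.
pose sg := (\sum_k t ord0 k)%R.
have fposE : fpos phi t = phi t by rewrite /fpos max_l // ltW.
have Pz : (cabs (P z) <= S * expR (phi t + C - e * l1norm t - sg))%R.
  rewrite PE; apply: le_trans (cabs_sum_le _ _) _.
  rewrite /S mulr_suml; apply: ler_sum => i _.
  rewrite cabsM ler_wpM2l ?cabs_ge0 // cabs_monom_expR // ler_expR -/t -/sg.
  by have := gapu i t; rewrite fposE; lra.
have Ew : expeR (- w z) <= (expR (c0 - phi t))%:E.
  rewrite -[(expR _)%:E]/(expeR (c0 - phi t)%:E) lee_expeR leeNl.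
  by rewrite -EFinN opprB; exact: wlow.
pose X : R := (B * expR (- (e * l1norm t) - sg))%R.
have gX : (cabs (P z))%:E * expeR (- w z) <= X%:E.
  apply: (@le_trans _ _ ((S * expR (phi t + C - e * l1norm t - sg))%:E * (expR (c0 - phi t))%:E)).
    by apply: lee_pmul; rewrite ?lee_fin ?cabs_ge0 // expeR_ge0.
  rewrite -EFinM lee_fin /X /B -!mulrA -!expRD le_eqVlt; apply/orP; left; apply/eqP.
  by congr (_ * expR _)%R; ring.
have g0 : 0 <= (cabs (P z))%:E * expeR (- w z).
  by rewrite mule_ge0 // ?lee_fin ?cabs_ge0 // expeR_ge0.
rewrite gee0_abs //.
apply: le_trans (lee_pmul g0 g0 gX gX) _.
rewrite -EFinM lee_fin.
have -> : (X * X = B ^+ 2 * expR (\sum_k (- (2 * t ord0 k) - 2 * e * `|t ord0 k|)))%R.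
  have -> : (\sum_k (- (2 * t ord0 k) - 2 * e * `|t ord0 k|) = - (2 * sg) - 2 * e * l1norm t)%R.
    by rewrite /sg /l1norm !mulr_sumr -sumrN -sumrB.
  have -> : (- (2 * sg) - 2 * e * l1norm t = (- (e * l1norm t) - sg) + (- (e * l1norm t) - sg))%R by ring.
  by rewrite expRD /X; ring.
apply: (@le_trans _ _ (B ^+ 2 * (16 * expR 2) ^+ n * \prod_(i < 2 * n) logw e (v i))%R); last first.
  rewrite ler_wpM2r ?lerDl //; apply: prodr_ge0 => j _; exact/ltW/logw_gt0.
rewrite -mulrA ler_wpM2l ?sqr_ge0 //.
rewrite (big_morph _ (@expRD R) (@expR0 R)) (prod_pairs n (fun j => logw e (v j))).
rewrite -[in (_ ^+ n)%R](card_ord n) -prodr_const -big_split /=.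
apply: ler_prod => k _; rewrite expR_ge0 /=.
have [va vb] := v1 k.
by have := polar_bound e0 e1 va vb; rewrite mxE.
Qed.

End Sufficiency.

(** * Continuity of polynomials *)

Section PolyContinuity.
Variables (R : realType) (n : nat) (z1 : Cn R n).

Definition cts_at (f : Cn R n -> R[i]) := forall e : R, 0 < e ->
  exists2 d : R, 0 < d & forall w, (forall k, cabs (w k - z1 k) <= d) ->
    cabs (f w - f z1) <= e.

Lemma cts_at_cst c : cts_at (fun=> c).
Proof.
move=> e e0; exists 1 => // w _.
by rewrite subrr -[0]/(Complex 0 0) cabs_real normr0 ltW.
Qed.

Lemma cts_at_coord k : cts_at (fun z => z k).
Proof. by move=> e e0; exists e. Qed.

Lemma cts_atD f g : cts_at f -> cts_at g -> cts_at (fun z => f z + g z).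
Proof.
move=> cf cg e e0; have e2 : 0 < e / 2 by rewrite divr_gt0.
have [d1 d10 H1] := cf _ e2; have [d2 d20 H2] := cg _ e2.
exists (Num.min d1 d2) => [|w wd]; first by rewrite lt_min d10.
have -> : f w + g w - (f z1 + g z1) = (f w - f z1) + (g w - g z1) by ring.
apply: le_trans (cabsD _ _) _; rewrite [leRHS]splitr; apply: lerD.
  by apply: H1 => k; apply: le_trans (wd k) _; rewrite ge_min lexx.
by apply: H2 => k; apply: le_trans (wd k) _; rewrite ge_min lexx orbT.
Qed.

Lemma cts_atM f g : cts_at f -> cts_at g -> cts_at (fun z => f z * g z).
Proof.
move=> cf cg e e0.
pose a := cabs (f z1) + 1; pose b := cabs (g z1) + 1.
have a0 : 0 < a by rewrite ltr_wpDl ?cabs_ge0.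
have b0 : 0 < b by rewrite ltr_wpDl ?cabs_ge0.
pose e1 := Num.min 1 (e / (2 * b)).
have e10 : 0 < e1 by rewrite lt_min ltr01 divr_gt0 // mulr_gt0.
have e20 : 0 < e / (2 * a) by rewrite divr_gt0 // mulr_gt0.
have [d1 d10 H1] := cf _ e10; have [d2 d20 H2] := cg _ e20.
exists (Num.min d1 d2) => [|w wd]; first by rewrite lt_min d10.
have h1 : cabs (f w - f z1) <= e1.
  by apply: H1 => k; apply: le_trans (wd k) _; rewrite ge_min lexx.
have h2 : cabs (g w - g z1) <= e / (2 * a).
  by apply: H2 => k; apply: le_trans (wd k) _; rewrite ge_min lexx orbT.
have -> : f w * g w - f z1 * g z1 = f w * (g w - g z1) + (f w - f z1) * g z1 by ring.
have fw : cabs (f w) <= a.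
  have -> : f w = f z1 + (f w - f z1) by ring.
  apply: le_trans (cabsD _ _) _; rewrite lerD2l (le_trans h1) // ge_min lexx //.
apply: le_trans (cabsD _ _) _; rewrite [leRHS]splitr !cabsM; apply: lerD.
  have -> : e / 2 = a * (e / (2 * a)) by field; rewrite gt_eqF.
  by apply: ler_pM; rewrite ?cabs_ge0.
have -> : e / 2 = (e / (2 * b)) * b by field; rewrite gt_eqF.
apply: ler_pM; rewrite ?cabs_ge0 //; last by rewrite lerDl.
by apply: le_trans h1 _; rewrite ge_min lexx orbT.
Qed.

Lemma cts_at_monom (J : 'I_n -> nat) : cts_at (monom J).
Proof.
have H (s : seq 'I_n) : cts_at (fun z => \prod_(k <- s) z k ^+ J k).
  elim: s => [|k s IH].
    by under eq_fun do rewrite big_nil; exact: cts_at_cst.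
  under eq_fun do rewrite big_cons; apply: cts_atM => //.
  elim: (J k) => [|j IHj]; first by under eq_fun do rewrite expr0; exact: cts_at_cst.
  by under eq_fun do rewrite exprS; apply: cts_atM => //; exact: cts_at_coord.
exact: H.
Qed.

Lemma cts_at_poly m (A : {set 'I_m}) (J : 'I_m -> 'I_n -> nat) (c : 'I_m -> R[i]) :
  cts_at (fun z => \sum_(i in A) c i * monom (J i) z).
Proof.
have H (s : seq 'I_m) : cts_at (fun z => \sum_(i <- s) c i * monom (J i) z).
  elim: s => [|i s IH].
    by under eq_fun do rewrite big_nil; exact: cts_at_cst.
  under eq_fun do rewrite big_cons; apply: cts_atD => //.
  by apply: cts_atM; [exact: cts_at_cst|exact: cts_at_monom].
have := H (enum A); congr cts_at; apply/funext => z; exact: big_enum.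
Qed.

End PolyContinuity.

(** * Divergence from infinitely many disjoint boxes *)

Section Boxes.
Variable R : realType.
Local Open Scope ereal_scope.

(** As the boxes are disjoint, the sum of [kap i] times the indicator of box i, over i < N, is a
    minorant of F; its integral is at least N eps for every N. *)
Lemma iter_int_boxes d (F : (nat -> R) -> \bar R) (lo hi : nat -> nat -> R)
    (kap : nat -> R) (eps : R) :
  (forall v, 0 <= F v) -> (forall i j, (lo i j < hi i j)%R) ->
  (forall i, (0 <= kap i)%R) -> (0 < eps)%R ->
  (forall i (v : nat -> R), (forall j : 'I_d, (lo i j <= v j <= hi i j)%R) -> (kap i)%:E <= F v) ->
  (forall i i', (i < i')%N -> exists j : 'I_d, forall x : R,
     (lo i j <= x <= hi i j)%R -> (lo i' j <= x <= hi i' j)%R -> False) ->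
  (forall i, (eps <= kap i * \prod_(j < d) (hi i j - lo i j))%R) ->
  iter_int d F = +oo.
Proof.
move=> F0 lohi kap0 eps0 kapF disj vol.
pose I i j := `[lo i j, hi i j]%classic : set R.
have Ilen i j : \int[@lebesgue_measure R]_x (\1_(I i j) x)%:E = (hi i j - lo i j)%:E.
  rewrite integral_indic ?setIT //; last exact: measurable_itv.
  by have := lebesgue_measure_itv `[lo i j, hi i j]%R; rewrite /= lte_fin lohi EFinB => <-.
have lower N : (N%:R * eps)%:E <= iter_int d F.
  apply: (@le_trans _ _ (iter_int d (fun v => \sum_(i < N) (kap i)%:E * \prod_(j < d) (\1_(I i j) (v j))%:E))).
    rewrite (@iter_int_sum_prod R d N (fun i => (kap i)%:E) (fun i j x => (\1_(I i j) x)%:E)).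
    - rewrite -[N in N%:R](card_ord N) mulr_natl -sumr_const -sumEFin; apply: lee_sum => i _.
      under eq_bigr do rewrite Ilen.
      by rewrite prodEFin -EFinM lee_fin; exact: vol.
    - by move=> i; rewrite lee_fin.
    - by move=> i j x; rewrite lee_fin.
    - by move=> i j; apply/measurable_EFinP; apply: measurable_indic; exact: measurable_itv.
  apply: le_iter_int => v.
  have out (i : nat) : ~ (forall j : 'I_d, (lo i j <= v j <= hi i j)%R) ->
      \prod_(j < d) (\1_(I i j) (v j))%:E = 0.
    move=> /existsNP [j vj]; rewrite prodEFin (bigD1 j) //= indicE.
    have nI : ~ I i j (v j) by move=> Iv; apply: vj; move: Iv; rewrite /I /= in_itv.
    by rewrite memNset // mul0r.
  have [[i Hi]|none] := pselect (exists i : 'I_N, forall j : 'I_d, (lo i j <= v j <= hi i j)%R).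
    rewrite (bigD1 i) //= [X in _ + X]big1 ?adde0.
      apply: le_trans (kapF _ _ Hi).
      rewrite prodEFin big1 ?mule1 // => j _.
      have Iv : I i j (v j) by rewrite /I /= in_itv; exact: Hi.
      by rewrite indicE mem_set.
    move=> i' ii'; rewrite out ?mule0 // => Hi'.
    have [lt|lt|/val_inj E] := ltngtP i i'.
    - by have [j Hj] := disj _ _ lt; exact: Hj (Hi j) (Hi' j).
    - by have [j Hj] := disj _ _ lt; exact: Hj (Hi' j) (Hi j).
    - by rewrite E eqxx in ii'.
  by rewrite big1 // => i _; rewrite out ?mule0 // => Hi; apply: none; exists i.
have F0' : 0 <= iter_int d F by exact: iter_int_ge0.
move: F0' lower; case: (iter_int d F) => [r|//|//] r0 lower.
have := lower (Num.bound (r / eps)).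
rewrite lee_fin leNgt -ltr_pdivrMr //.
by rewrite archi_boundP // divr_ge0 // ltW.
Qed.

End Boxes.

(** * Divergence along a ray when J + 1 is not interior *)

Section Necessity.
Variables (R : realType) (n : nat).

Lemma coordinates_ex (z : Cn R n) : exists x : nat -> R, forall k : 'I_n,
  x (2 * k)%N = complex.Re (z k) /\ x (2 * k).+1 = complex.Im (z k).
Proof.
exists (fun j => if insub j./2 is Some k then
  (if odd j then complex.Im (z k) else complex.Re (z k)) else 0) => k.
have e1 : (2 * k)./2 = k by rewrite mul2n doubleK.
have e2 : (2 * k).+1./2 = k by rewrite mul2n /= uphalf_double.
have o1 : odd (2 * k) = false by rewrite mul2n odd_double.
by rewrite e1 e2 /= o1 /= valK.
Qed.

Lemma cabs_le_ReIm (z : R[i]) : cabs z <= `|complex.Re z| + `|complex.Im z|.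
Proof.
have := cabsD (Complex (complex.Re z) 0) (Complex 0 (complex.Im z)).
rewrite -[Complex _ 0 + _]/(Complex (complex.Re z + 0) (0 + complex.Im z)) addr0 add0r.
rewrite cabs_real {2}/cabs /= expr0n add0r sqrtr_sqr.
by case: z.
Qed.

Lemma Re_le_cabs (z : R[i]) : `|complex.Re z| <= cabs z.
Proof. by rewrite /cabs -sqrtr_sqr ler_wsqrtr // lerDl sqr_ge0. Qed.

Lemma monom_scale (J : 'I_n -> nat) (t : 'I_n -> R) (w : Cn R n) :
  monom J (fun k => Complex (expR (t k)) 0 * w k) =
  Complex (expR (\sum_k (J k)%:R * t k)) 0 * monom J w.
Proof.
have H : Complex (expR (\sum_k (J k)%:R * t k)) 0 = \prod_k Complex (expR (t k)) 0 ^+ J k.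
  rewrite -[LHS]/((expR (\sum_k (J k)%:R * t k))%:C)%C.
  rewrite (big_morph _ (@expRD R) (@expR0 R)) rmorph_prod; apply: eq_bigr => k _.
  by rewrite expRM_natl rmorphXn.
by rewrite H /monom -big_split /=; apply: eq_bigr => k _; rewrite exprMn.
Qed.

Variable u : Cn R n -> \bar R.
Hypotheses (n0 : (0 < n)%N) (Lu : LPSHstar u) (toru : toric u).
Local Notation phi := (phi u).
Local Notation rec := (recess phi).

(* If J + 1 is not strictly below the recession function in the direction t0, then on
   the translates e^{s t0} W of a box W (in logarithmic coordinates: on a tube around
   the ray spanned by t0) the integral of |P|^2 e^{-2w} does not decay, by homogeneity.
   Minimality of A guarantees that the part of P dominating along t0 is not zero. *)
Lemma L2inf_strict_below (w : Cn R n -> \bar R) (c0 : R) m (J : 'I_m -> 'I_n -> nat)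
    (c : 'I_m -> R[i]) (A : {set 'I_m}) (P : Cn R n -> R[i]) :
  (forall z, (forall k, z k != 0) -> (w z <= (rec (lnv z) + c0)%:E)%E) ->
  (forall z, P z = \sum_(i in A) c i * monom (J i) z) ->
  (forall B : {set 'I_m}, B \proper A ->
     ~ forall z, P z = \sum_(i in B) c i * monom (J i) z) ->
  L2inf (fun z => (cabs (P z))%:E * expeR (- w z))%E ->
  forall i, i \in A -> strict_below phi (shift1 R (J i)).
Proof.
move=> wup PE minA [K [cK intK]] i0 Ai0 t0 t00.
rewrite ltNge; apply/negP => le0.
pose mu i := dotp (shift1 R (J i)) t0.
have [i1 Ai1 mumax] : exists2 i1, i1 \in A & forall i, i \in A -> mu i <= mu i1.
  by case: (@arg_maxP _ _ _ i0 (mem A) mu Ai0) => i1 ? ?; exists i1.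
pose M := mu i1.
have mu0 : Num.max (rec t0) 0 <= mu i0 by [].
have rM : rec t0 <= M.
  by apply: le_trans (mumax _ Ai0); apply: le_trans mu0; rewrite le_max lexx.
(* All entries of J + 1 are positive, so <J + 1, t0> >= 0 with t0 nonzero forces a positive
   component. In this coordinate the boxes leave K and become disjoint. *)
have [k0 k0p] : exists k, 0 < t0 ord0 k.
  apply: contrapT => npos.
  have tle k : t0 ord0 k <= 0 by rewrite leNgt; apply/negP => tk; apply: npos; exists k.
  have [k tk] : exists k, t0 ord0 k != 0.
    apply: contrapT => H; move/eqP: t00; apply; apply/rowP => k; rewrite mxE.
    by apply/eqP; apply: contrapT => tk; apply: H; exists k; apply/negP.
  have : mu i0 < 0.
    rewrite /mu /dotp (bigD1 k) //= mxE.
    apply: (@le_lt_trans _ _ ((J i0 k).+1%:R * t0 ord0 k)).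
      rewrite gerDl; apply: sumr_le0 => j _; rewrite mxE.
      by rewrite mulr_ge0_le0.
    by rewrite pmulr_rlt0 ?ltr0n // lt_neqAle tk tle.
  by rewrite ltNge (le_trans _ mu0) // le_max lexx orbT.
pose F := [set i in A | mu i == M].
pose Q z := \sum_(i in F) c i * monom (J i) z.
have FA : F \subset A by apply/fintype.subsetP => i; rewrite inE => /andP[].
have PQ z : P z = Q z + \sum_(i in A :\: F) c i * monom (J i) z.
  by rewrite PE (big_setID F) /= (finset.setIidPr FA).
have [z1 Qz1] : exists z1, Q z1 != 0.
  apply: contrapT => H; apply: (minA (A :\: F)).
    apply/fintype.properP; split; first exact: finset.subsetDl.
    by exists i1 => //; rewrite !inE Ai1 eqxx.
  move=> z; rewrite PQ; have -> : Q z = 0; last by rewrite add0r.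
  by apply/eqP; apply: contrapT => Qz; apply: H; exists z; apply/negP.
pose q := cabs (Q z1) / 2.
have q0 : 0 < q by rewrite divr_gt0 // cabs_gt0.
have [d d0 Qd] := cts_at_poly z1 F J c q0.
pose h := d / 8.
have h0 : 0 < h by rewrite divr_gt0.
have [x xE] := coordinates_ex z1.
(* Moving the centre by 2 h away from 0 keeps the box of half-width h at distance h from 0 and
   within 3 h of x. In modulus this is within 6 h <= d of z1. *)
pose p j := x j + (if 0 <= x j then 1 else -1) * (2 * h).
(* [tn] repeats t0_k for the real and the imaginary coordinate of z_k, which are scaled alike. *)
have [tn tnE] := coordinates_ex (fun k => Complex (t0 ord0 k) (t0 ord0 k)).
rewrite /= in tnE.
have near_p j y : p j - h <= y <= p j + h -> `|y - x j| <= 3 * h /\ h <= `|y|.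
  rewrite /p => /andP[]; case: (leP 0 (x j)) => xj y1 y2; split.
  - by rewrite ler_norml; apply/andP; split; lra.
  - by apply: le_trans (ler_norm _); lra.
  - by rewrite ler_norml; apply/andP; split; lra.
  - by rewrite -normrN; apply: le_trans (ler_norm _); lra.
pose hi0 := `|p (2 * k0)%N| + h.
have hi00 : 0 < hi0 by rewrite ltr_wpDl.
(* A translation by tau along t0 sends the lower bound h for |Re z_k0| beyond the upper bound [hi0],
   so boxes spaced by tau are disjoint. *)
pose tau := hi0 / h / t0 ord0 k0.
have tau0 : 0 < tau by rewrite !divr_gt0.
have tauh : hi0 < expR (tau * t0 ord0 k0) * h.
  have -> : tau * t0 ord0 k0 = hi0 / h by rewrite /tau divfK // gt_eqF.
  have h1 := expR_ge1Dx (hi0 / h).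
  apply: (@lt_le_trans _ _ ((1 + hi0 / h) * h)); last by rewrite ler_pM2r.
  by rewrite mulrDl divfK ?gt_eqF // mul1r ltrDr.
pose H := \sum_k cabs (z1 k) + d.
have H0 : 0 < H by rewrite ltr_wpDl // sumr_ge0 // => k _; exact: cabs_ge0.
pose Bd i := \prod_k H ^+ J i k.
have Bd0 i : 0 <= Bd i by apply: prodr_ge0 => k _; rewrite exprn_ge0 // ltW.
pose r1 := rec (const_mx (ln H)).
pose s0 := \sum_k t0 ord0 k.
have [BK KB] : exists B : R, forall z, K z -> forall k, `|complex.Re (z k)| <= B.
  have [B [_ KB]] := compact_bounded cK.
  exists (B + 1) => z Kz k.
  pose Z : 'M[R]_(n, 2) := \matrix_(i, j) (if j == ord0 then complex.Re (z i) else complex.Im (z i)).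
  have rZ : realify Z = z.
    by apply/funext => i; rewrite /realify !mxE /=; case: (z i).
  have := KB (B + 1) ltac:(by rewrite ltrDl) Z.
  rewrite /= rZ => /(_ Kz); apply: le_trans.
  rewrite -[leRHS]/(mx_norm Z) mx_normrE; apply/bigmax_geP; right => /=.
  by exists (k, ord0) => //=; rewrite mxE eqxx.
(* Beyond S0 the terms of P outside F add up to at most q / 2 relative to the dominating part, and
   the translated box misses K. *)
have [S0 HS] : exists S0 : R, forall s, S0 < s -> [/\ 0 < s,
    forall i, i \in A :\: F -> cabs (c i) * Bd i * expR (s * (mu i - M)) <= q / 2 / m.+1%:R &
    BK < expR (s * t0 ord0 k0) * h].
  have : \forall s \near +oo%R, [/\ 0 < s,
    forall i, i \in A :\: F -> cabs (c i) * Bd i * expR (s * (mu i - M)) <= q / 2 / m.+1%:R &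
    BK < expR (s * t0 ord0 k0) * h].
    have N1 i : \forall s \near +oo%R, i \in A :\: F ->
        cabs (c i) * Bd i * expR (s * (mu i - M)) <= q / 2 / m.+1%:R.
      have [iAF|_] := boolP (i \in A :\: F); last by near=> s.
      have lt_mu : 0 < M - mu i.
        move: iAF; rewrite !inE => /andP[/nandP[/negP//|neq] Ai].
        by rewrite subr_gt0 lt_neqAle neq mumax.
      set a := cabs (c i) * Bd i; have a0 : 0 <= a by rewrite mulr_ge0 // cabs_ge0.
      set b := q / 2 / _; have b0 : 0 < b.
        by rewrite /b divr_gt0 // divr_gt0.
      near=> s => _.
      have s_gt0 : 0 < s by near: s; apply: nbhs_pinfty_gt; rewrite num_real.
      have sa : a / b / (M - mu i) <= s by near: s; apply: nbhs_pinfty_ge; rewrite num_real.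
      rewrite -[mu i - M]opprB mulrN expRN ler_pdivrMr ?expR_gt0 // mulrC -ler_pdivrMr //.
      apply: le_trans (_ : s * (M - mu i) <= _); first by rewrite -ler_pdivrMr.
      by have := expR_ge1Dx (s * (M - mu i)); lra.
    have N2 : \forall s \near +oo%R, BK < expR (s * t0 ord0 k0) * h.
      near=> s; rewrite -ltr_pdivrMr //.
      apply: (@lt_trans _ _ (s * t0 ord0 k0)).
        by rewrite -ltr_pdivrMr //; near: s; apply: nbhs_pinfty_gt; rewrite num_real.
      by apply: lt_le_trans (expR_ge1Dx _); rewrite ltrDr.
    have N1' : \forall s \near +oo%R, forall i, i \in A :\: F ->
        cabs (c i) * Bd i * expR (s * (mu i - M)) <= q / 2 / m.+1%:R.
      exact: filter_forall N1.
    near=> s; split.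
    - by near: s; apply: nbhs_pinfty_gt; rewrite num_real.
    - by near: s; exact: N1'.
    - by near: s; exact: N2.
  by move=> [S0 [_ HS]]; exists S0.
pose M0 := (Num.bound (`|S0| / tau)).+1.
pose sig (i : nat) : R := (M0 + i)%:R * tau.
have sigS i : S0 < sig i.
  apply: le_lt_trans (ler_norm _) _; rewrite /sig -ltr_pdivrMr //.
  apply: lt_le_trans (archi_boundP _) _; first by rewrite divr_ge0 // ltW.
  by rewrite ler_nat /M0 addSn -addnS leq_addr.
pose lo i j := expR (sig i * tn j) * (p j - h).
pose hi i j := expR (sig i * tn j) * (p j + h).
have scl i j y : lo i j <= y <= hi i j -> p j - h <= expR (- (sig i * tn j)) * y <= p j + h.
  by rewrite /lo /hi expRN ler_pdivlMl ?ler_pdivrMl ?expR_gt0.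
pose kp := (q / 2 * expR (- r1 - c0)) ^+ 2.
have kp0 : 0 < kp by rewrite exprn_gt0 // mulr_gt0 ?expR_gt0 // divr_gt0.
(* The growth e^{sig M} of |P| is at least matched by e^{-w}, as w is at most sig M plus a constant.
   The factor left over is the inverse of the volume scaling of box i, so [kap i] times the volume
   is constant. *)
pose kap i := kp * expR (- (2 * sig i * s0)).
pose G (v : nat -> R) : Cn R n := fun k => Complex (v (2 * k)%N) (v (2 * k).+1).
have ord2 (k : 'I_n) : ((2 * k).+1 < 2 * n)%N.
  by have := ltn_ord k; rewrite -(leq_pmul2l (isT : 0 < 2)%N) mulnS.
suff : cn_integral (fun z : Cn R n => if `[< K z >] then 0%E else
   (`|(cabs (P z))%:E * expeR (- w z)| * `|(cabs (P z))%:E * expeR (- w z)|)%E) = +oo%E.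
  by move=> E; move: intK; rewrite E ltxx.
apply: (@iter_int_boxes R (2 * n) _ lo hi kap (kp * (2 * h) ^+ (2 * n))).
- by move=> v; case: ifP => // _; rewrite mule_ge0.
- by move=> i j; rewrite /lo /hi ltr_pM2l ?expR_gt0 //; lra.
- by move=> i; rewrite mulr_ge0 ?expR_ge0 // ltW.
- by rewrite mulr_gt0 // exprn_gt0 // mulr_gt0.
- move=> i v box.
  rewrite -[X in (_ <= X)%E]/(if `[< K (G v) >] then 0%E else
    (`|(cabs (P (G v)))%:E * expeR (- w (G v))| * `|(cabs (P (G v)))%:E * expeR (- w (G v))|)%E).
  have [sg0 sgF sgK] := HS _ (sigS i).
  set sg := sig i in sg0 sgF sgK *.
  pose W : Cn R n := fun k =>
    Complex (expR (- (sg * t0 ord0 k)) * v (2 * k)%N) (expR (- (sg * t0 ord0 k)) * v (2 * k).+1).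
  have GW : G v = (fun k => Complex (expR (sg * t0 ord0 k)) 0 * W k).
    apply/funext => k; rewrite /G /W.
    have E y : y = expR (sg * t0 ord0 k) * (expR (- (sg * t0 ord0 k)) * y).
      by rewrite mulrA -expRD subrr expR0 mul1r.
    apply/eqP; rewrite eq_complex /= !mul0r subr0 addr0 -!E !eqxx //.
  have Wb (k : 'I_n) : (`|complex.Re (W k - z1 k)| <= 3 * h /\ h <= `|complex.Re (W k)|) /\
      `|complex.Im (W k - z1 k)| <= 3 * h.
    have b1 := box (Ordinal (ltnW (ord2 k))); have b2 := box (Ordinal (ord2 k)).
    have [x1 x2] := xE k; have [t1 t2] := tnE k.
    have [h1 h2] := near_p _ _ (scl _ _ _ b1); have [h3 _] := near_p _ _ (scl _ _ _ b2).
    move: h1 h2 h3; rewrite /= x1 x2 t1 t2.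
    by case: (z1 k).
  have Wd k : cabs (W k - z1 k) <= d.
    have [[h1 _] h2] := Wb k; apply: le_trans (cabs_le_ReIm _) _.
    by move: h1 h2; rewrite /h; lra.
  have Wh k : h <= cabs (W k).
    by have [[_ h1] _] := Wb k; apply: le_trans h1 (Re_le_cabs _).
  have WH k : cabs (W k) <= H.
    have -> : W k = z1 k + (W k - z1 k) by rewrite addrC subrK.
    apply: le_trans (cabsD _ _) _; apply: lerD => //.
    by rewrite (bigD1 k) //= lerDl sumr_ge0 // => j _; exact: cabs_ge0.
  have W0 k : W k != 0 by rewrite -cabs_gt0; exact: lt_le_trans (Wh k).
  have G0 k : G v k != 0.
    by rewrite GW mulf_neq0 // -cabs_gt0 cabs_real normr_gt0 gt_eqF // expR_gt0.
  have nK : ~ K (G v).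
    move=> /KB /(_ k0); apply/negP; rewrite -ltNge; apply: lt_le_trans sgK _.
    rewrite GW /=.
    have [[_ h1] _] := Wb k0; rewrite mul0r subr0 normrM gtr0_norm ?expR_gt0 //.
    by rewrite ler_pM2l ?expR_gt0.
  have -> : `[< K (G v) >] = false by apply/asboolPn.
  have lnG : lnv (G v) = sg *: t0 + lnv W.
    apply/rowP => k; rewrite GW !mxE cabsM cabs_real gtr0_norm ?expR_gt0 //.
    by rewrite lnM ?posrE ?expR_gt0 ?cabs_gt0 // expRK.
  have recG : rec (lnv (G v)) <= sg * M + r1.
    rewrite lnG; apply: le_trans (recess_subadd _ _ _ _ _) _.
    - exact: phi_convex.
    - exact: phi_mono.
    - exact: phi_growth.
    (* Positive homogeneity turns the translate into sg times the value at t0, at most M; the other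
       term is bounded on W by monotonicity. *)
    apply: lerD.
      apply: le_trans (recessZ_le _ _ _ _ sg0) _.
      - exact: phi_convex.
      - exact: phi_mono.
      - exact: phi_growth.
      by rewrite ler_pM2l.
    apply: recess_mono.
    - exact: phi_convex.
    - exact: phi_mono.
    - exact: phi_growth.
    by move=> k; rewrite !mxE ler_ln ?posrE ?cabs_gt0.
  have Ew : ((expR (- (sg * M + r1 + c0)))%:E <= expeR (- w (G v)))%E.
    rewrite -[(expR _)%:E]/(expeR (- (sg * M + r1 + c0))%:E) lee_expeR EFinN leeN2.
    by apply: le_trans (wup _ G0) _; rewrite lee_fin lerD2r.
  have PG : expR (sg * (M - s0)) * (q / 2) <= cabs (P (G v)).
    have term (B : {set 'I_m}) : \sum_(i in B) c i * monom (J i) (G v) =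
       Complex (expR (sg * (M - s0))) 0 *
       \sum_(i in B) c i * (Complex (expR (sg * (mu i - M))) 0 * monom (J i) W).
      rewrite mulr_sumr; apply: eq_bigr => i' _; rewrite GW monom_scale.
      have -> : Complex (expR (\sum_k (J i' k)%:R * (sg * t0 ord0 k))) 0 =
          Complex (expR (sg * (M - s0))) 0 * Complex (expR (sg * (mu i' - M))) 0.
        rewrite -[RHS]/(((expR (sg * (M - s0)))%:C)%C * ((expR (sg * (mu i' - M)))%:C)%C).
        rewrite -rmorphM -expRD -mulrDr; congr ((expR _)%:C)%C.
        have -> : M - s0 + (mu i' - M) = mu i' - s0 by ring.
        rewrite /mu /dotp /s0 -sumrB mulr_sumr; apply: eq_bigr => k _.
        by rewrite mxE -natr1; ring.
      by ring.
    have QE : \sum_(i in F) c i * (Complex (expR (sg * (mu i - M))) 0 * monom (J i) W) = Q W.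
      apply: eq_bigr => i'; rewrite inE => /andP[_ /eqP ->].
      by rewrite subrr mulr0 expR0 -[Complex 1 0]/(1 : R[i]) mul1r.
    rewrite PQ /Q !term -mulrDr cabsM cabs_real gtr0_norm ?expR_gt0 // ler_pM2l ?expR_gt0 //.
    rewrite QE; set rest := \sum_(i in _) _.
    have QW : q <= cabs (Q W).
      have e1 : cabs (Q z1) <= cabs (Q W) + cabs (Q W - Q z1).
        rewrite -[cabs (Q W - Q z1)]cabsN.
        by have := cabsD (Q W) (- (Q W - Q z1)); rewrite opprB addrC subrK addrC.
      have e2 : cabs (Q W - Q z1) <= q by exact: Qd.
      have e3 : cabs (Q z1) = 2 * q by rewrite /q; field.
      lra.
    have restle : cabs rest <= q / 2.
      apply: le_trans (cabs_sum_le _ _) _.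
      apply: (@le_trans _ _ (\sum_(i in A :\: F) q / 2 / m.+1%:R)).
        apply: ler_sum => i' iF; apply: le_trans (sgF _ iF).
        rewrite !cabsM cabs_real gtr0_norm ?expR_gt0 // -mulrA ler_wpM2l ?cabs_ge0 //.
        rewrite mulrC ler_pM2r ?expR_gt0 // cabs_monom; apply: ler_prod => k _.
        by rewrite exprn_ge0 ?cabs_ge0 //= lerXn2r ?nnegrE ?cabs_ge0 // ltW.
      rewrite sumr_const -[_ *+ _]mulr_natr -[leLHS]mulrA ler_piMr //.
        by rewrite ltW // divr_gt0.
      rewrite mulrC ler_pdivrMr ?ltr0n // mul1r ler_nat.
      apply: leq_trans (max_card _) _; rewrite card_ord; exact: leqnSn.
    have e1 : cabs (Q W) <= cabs (Q W + rest) + cabs rest.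
      have := cabsD (Q W + rest) (- rest); rewrite addrK cabsN; exact.
    lra.
  pose Y := q / 2 * expR (- r1 - c0) * expR (- (sg * s0)).
  have Y0 : (0 <= Y%:E)%E.
    by rewrite lee_fin mulr_ge0 ?expR_ge0 // mulr_ge0 ?expR_ge0 // ltW // divr_gt0.
  have YG : (Y%:E <= (cabs (P (G v)))%:E * expeR (- w (G v)))%E.
    apply: (@le_trans _ _ ((expR (sg * (M - s0)) * (q / 2))%:E * (expR (- (sg * M + r1 + c0)))%:E)%E).
      rewrite -EFinM lee_fin le_eqVlt; apply/orP; left; apply/eqP.
      rewrite /Y; move: (q / 2) => qh.
      by rewrite [_ * qh]mulrC -!mulrA -!expRD; congr (_ * expR _); ring.
    apply: lee_pmul => //; rewrite lee_fin ?expR_ge0 //.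
    by rewrite mulr_ge0 ?expR_ge0 // ltW // divr_gt0.
  have -> : kap i = Y * Y.
    rewrite /kap /kp /Y -/sg.
    have -> : expR (- (2 * sg * s0)) = expR (- (sg * s0)) * expR (- (sg * s0)).
      by rewrite -expRD; congr expR; ring.
    by ring.
  rewrite gee0_abs; last exact: le_trans YG.
  by rewrite EFinM; apply: lee_pmul.
(* The boxes are separated in the real part of z_k0: rescaled by [sig i'], a point of box i has
   modulus below h there, whereas box i' requires at least h. *)
- move=> i i' ii'; exists (Ordinal (ltnW (ord2 k0))) => y /= b1 b2.
  have [tnk _] := tnE k0.
  have h1 := scl _ _ _ b1; have [_ h2] := near_p _ _ (scl _ _ _ b2).
  rewrite tnk in h1 h2.
  have n1 : `|expR (- (sig i * t0 ord0 k0)) * y| <= hi0.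
    move: h1 => /andP[h1 h1']; rewrite /hi0 ler_norml.
    have := ler_norm (p (2 * k0)%N); have := ler_norm (- p (2 * k0)%N); rewrite normrN.
    by move=> *; apply/andP; split; lra.
  have sig_le : sig i + tau <= sig i'.
    by rewrite /sig -[X in _ + X]mul1r -mulrDl ler_pM2r // natr1 ler_nat -addnS leq_add2l.
  move: h2; apply/negP; rewrite -ltNge.
  have -> : expR (- (sig i' * t0 ord0 k0)) * y =
      expR (- ((sig i' - sig i) * t0 ord0 k0)) * (expR (- (sig i * t0 ord0 k0)) * y).
    by rewrite mulrA -expRD; congr (expR _ * _); ring.
  rewrite normrM gtr0_norm ?expR_gt0 //.
  apply: (@le_lt_trans _ _ (expR (- (tau * t0 ord0 k0)) * hi0)).
    apply: ler_pM; rewrite ?expR_ge0 // ler_expR lerN2 ler_pM2r //; lra.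
  by rewrite expRN ltr_pdivrMl ?expR_gt0.
- move=> i; rewrite /kap.
  have -> : \prod_(j < 2 * n) (hi i j - lo i j) = expR (2 * sig i * s0) * (2 * h) ^+ (2 * n).
    rewrite (eq_bigr (fun j : 'I_(2 * n) => expR (sig i * tn j) * (2 * h))) => [|j _]; last first.
      by rewrite /hi /lo; ring.
    rewrite big_split /= prodr_const card_ord; congr (_ * _).
    rewrite (prod_pairs n (fun j => expR (sig i * tn j))) /s0 mulr_sumr.
    rewrite (big_morph _ (@expRD R) (@expR0 R)); apply: eq_bigr => k _.
    by have [-> ->] := tnE k; rewrite -expRD; congr expR; ring.
  rewrite -mulrA [X in _ <= _ * X]mulrA -expRD addNr expR0 mul1r //.
Unshelve. all: by end_near.
Qed.

End Necessity.

(** * Weights between phi - c and psi_u + c *)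

Section Characterization.
Variables (R : realType) (n : nat).

(** Minimality takes the place of linear independence of monomials: the exponents J i may repeat and
    coefficients may vanish, but no part of a smallest support sums to zero. *)
Lemma minimal_support m (J : 'I_m -> 'I_n -> nat) (c : 'I_m -> R[i]) (P : Cn R n -> R[i]) :
  (forall z, P z = \sum_(i < m) c i * monom (J i) z) ->
  exists A : {set 'I_m}, (forall z, P z = \sum_(i in A) c i * monom (J i) z) /\
    forall B : {set 'I_m}, B \proper A -> ~ forall z, P z = \sum_(i in B) c i * monom (J i) z.
Proof.
move=> PE.
pose good (B : {set 'I_m}) := `[< forall z, P z = \sum_(i in B) c i * monom (J i) z >].
have goodT : good [set: 'I_m]%SET.
  by apply/asboolP => z; rewrite PE; apply: eq_bigl => i; rewrite inE.
case: (@arg_minnP _ _ good (fun B : {set 'I_m} => #|B|) goodT) => A /asboolP gA minA.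
exists A; split => // B /proper_card ltBA /asboolP gB.
by have := minA B gB; rewrite leqNgt ltBA.
Qed.

Variable u : Cn R n -> \bar R.
Hypotheses (Lu : LPSHstar u) (toru : toric u).

Definition in_interior_span (P : Cn R n -> R[i]) :=
  exists m (J : 'I_m -> 'I_n -> nat) (c : 'I_m -> R[i]),
    (forall i, interior (Gamma_inf u) (shift1 R (J i))) /\
    forall z, P z = \sum_(i < m) c i * monom (J i) z.

Lemma P_inf_of_bounds (w : Cn R n -> \bar R) (c0 : R) (P : Cn R n -> R[i]) : (0 < n)%N ->
  (forall z, (forall k, z k != 0) ->
     ((phi u (lnv z) - c0)%:E <= w z <= (recess (phi u) (lnv z) + c0)%:E)%E) ->
  P_inf w P <-> in_interior_span P.
Proof.
move=> n0 wb.
have cvx : convex_fun (phi u) by exact: phi_convex.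
have uscp := phi_usc n0 Lu toru.
have mon := phi_mono n0 Lu toru.
have gro := phi_growth n0 Lu toru.
have GE := Gamma_infE n0 Lu toru.
split=> [[[m [J [c PE]]] L2]|[m [J [c [intJ PE]]]]].
- have [A [PA minA]] := minimal_support PE.
  have wup z : (forall k, z k != 0) -> (w z <= (recess (phi u) (lnv z) + c0)%:E)%E.
    by move=> /wb /andP[].
  have sb := L2inf_strict_below n0 Lu toru wup PA minA L2.
  exists #|A|, (fun i => J (enum_val i)), (fun i => c (enum_val i)); split.
    move=> i; rewrite GE; apply: coercive_interior => //.
    by apply: strict_below_coercive => //; apply: sb; exact: enum_valP.
  by move=> z; rewrite PA big_enum_val.
- split; first by exists m, J, c.
  have wlow z : (forall k, z k != 0) -> ((phi u (lnv z) - c0)%:E <= w z)%E.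
    by move=> /wb /andP[].
  apply: (L2inf_of_gap n0 Lu toru wlow _ PE) => i.
  apply: strict_below_coercive => //; apply: interior_strict_below => //.
  by rewrite -GE.
Qed.

Lemma P_inf_u P : (0 < n)%N -> P_inf u P <-> in_interior_span P.
Proof.
move=> n0; apply: (@P_inf_of_bounds _ `|phi u 0|) => // z z0.
rewrite (toric_torus toru z0) u_expvE // !lee_fin; apply/andP; split.
  by rewrite gerBl.
apply: le_trans (f_le_recess _ _ _ _) _.
- exact: phi_convex.
- exact: phi_mono.
- exact: phi_growth.
by rewrite lerD2l ler_norm.
Qed.

Lemma P_inf_Psi P : (0 < n)%N -> P_inf (Psi u) P <-> in_interior_span P.
Proof.
move=> n0; apply: (@P_inf_of_bounds _ `|phi u 0|) => // z z0.
rewrite Psi_torus // !lee_fin; apply/andP; split; last by rewrite lerDl.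
rewrite lerBlDr; apply: le_trans (f_le_recess _ _ _ _) _.
- exact: phi_convex.
- exact: phi_mono.
- exact: phi_growth.
by rewrite lerD2l ler_norm.
Qed.

End Characterization.

(** * The case n = 0 *)

Section DimensionZero.
Variable R : realType.
Implicit Type u : Cn R 0 -> \bar R.

(** C^0 is a single point and compact, so K can be the whole space and the integral vanishes. *)
Lemma P_inf_dim0 u P : P_inf u P <-> is_poly P.
Proof.
split=> [[]//|polyP]; split=> //; exists setT; split.
  rewrite /cn_compact (_ : _ @^-1` _ = [set A : 'M[R]_(0, 2) | forall i j, `|A i j| <= 0]).
    exact: compact_matrix_box.
  by apply/seteqP; split=> A //= _ [].
rewrite /cn_integral /=.
by have -> : `[< [set: Cn R 0] (fun k : 'I_0 => Complex 0 0) >] by apply/asboolP.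
Qed.

Lemma Gamma_inf_dim0 u : Gamma_inf u = setT.
Proof.
apply/seteqP; split=> // a _ t.
by rewrite big_ord0 le_max lexx orbT.
Qed.

End DimensionZero.

Theorem theorem8p5 (R : realType) (n : nat) (u : Cn R n -> \bar R) :
  LPSHstar u -> toric u -> (c_inf u < 1%:E)%E ->
  (forall P : Cn R n -> R[i], P_inf u P <-> P_inf (Psi u) P) /\
  (forall P : Cn R n -> R[i], P_inf u P <->
     exists m (J : 'I_m -> 'I_n -> nat) (c : 'I_m -> R[i]),
       (forall i, interior (Gamma_inf u) (shift1 R (J i))) /\
       forall z, P z = \sum_(i < m) c i * monom (J i) z).
Proof.
(* Dimension 0 is apart because finiteness of u on the torus is obtained by going to infinity along
   a coordinate. *)
move=> Lu toru _; case: n u Lu toru => [|n] u Lu toru; last first.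
  split=> P; last exact: P_inf_u.
  exact: iff_trans (P_inf_u Lu toru P isT) (iff_sym (P_inf_Psi Lu toru P isT)).
split=> P; rewrite !P_inf_dim0 //.
split=> [[m [J [c PE]]]|[m [J [c [_ PE]]]]]; exists m, J, c => //; split=> // i.
by rewrite Gamma_inf_dim0 interiorT.
Qed.
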